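(* Let $f\in L^\infty([-\pi,\pi])$ be complex-valued with Fourier coefficients $f_k=\frac1{2\pi}\int_{-\pi}^{\pi} f(x)e^{-\mathrm{i}kx}\,dx$, $k\in\mathbb Z$, and suppose that $|\!|\!|f|\!|\!|^2:=\sum_{k=-\infty}^{\infty}|k|\,|f_k|^2<\infty$. Let $G\in C^3_c(\mathbb R)$. Then, for every integer $n\ge 1$, $$\left|\sum_{j=1}^n G\big(\sigma_j(T_n(f))^2\big)-\frac{n}{2\pi}\int_{-\pi}^{\pi}G\big(|f(\theta)|^2\big)\,d\theta\right|\le 2\,|\!|\!|f|\!|\!|^2\left[c_1+2c_2\|f\|_\infty^2\right],$$ where $c_1=2\|G'\|_1+\sqrt2\,\|G''\|_2$ and $c_2=2\|G''\|_1+\sqrt2\,\|G'''\|_2$.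
   Context: For $f\in L^1([-\pi,\pi])$ with Fourier coefficients $f_k=\frac1{2\pi}\int_{-\pi}^{\pi} f(x)e^{-\mathrm{i}kx}\,dx$, the $n$-th Toeplitz matrix generated by $f$ is the $n\times n$ matrix $T_n(f)=[f_{i-j}]_{i,j=1}^n$. For $A\in\mathbb C^{n\times n}$, $\sigma_1(A),\dots,\sigma_n(A)$ denote the singular values of $A$ (counted with multiplicity). $C^3_c(\mathbb R)$ is the space of three times continuously differentiable complex-valued functions on $\mathbb R$ with bounded support. $\|g\|_p$ denotes the $L^p$-norm of the function $g$ over its domain with respect to Lebesgue measure ($\mathbb R$ for $G',G'',G'''$, and $[-\pi,\pi]$ for $f$; $\|f\|_\infty$ is the essential supremum of $|f|$). *)

(* Defs.v *)
From mathcomp Require Import all_boot all_order all_algebra.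
From mathcomp Require Import all_classical all_reals all_analysis.
From mathcomp Require Import complex.

Set Implicit Arguments.
Unset Strict Implicit.
Unset Printing Implicit Defensive.

Import Order.TTheory GRing.Theory Num.Theory.
Import numFieldNormedType.Exports.
Export numFieldNormedType.Exports.

Local Open Scope classical_set_scope.
Local Open Scope ring_scope.
Local Open Scope complex_scope.

(** [R : realType] is the field of real numbers and [R[i]] that of complex
    numbers; [Normc.normc] is the real-valued modulus.  As [R[i]] carries
    neither a measurable nor a normed-module structure over [R], measurability,
    integration and differentiation of complex-valued functions are
    componentwise. *)
Section Complex_valued_functions.
Variable R : realType.
Local Notation mu := (@lebesgue_measure R).

Definition cmeasurable (D : set R) (f : R -> R[i]) : Prop :=
  measurable_fun D (fun x => complex.Re (f x)) /\
  measurable_fun D (fun x => complex.Im (f x)).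

Definition cintegral (D : set R) (f : R -> R[i]) : R[i] :=
  (\int[mu]_(x in D) complex.Re (f x)) +i* (\int[mu]_(x in D) complex.Im (f x)).

Definition cderive (k : nat) (f : R -> R[i]) (x : R) : R[i] :=
  derive1n k (fun y => complex.Re (f y)) x
  +i* derive1n k (fun y => complex.Im (f y)) x.

Definition continuously_differentiable (k : nat) (g : R -> R) : Prop :=
  (forall (i : nat) (x : R), (i < k)%N -> derivable (derive1n i g) x 1) /\
  continuous (derive1n k g).

Definition C3c (G : R -> R[i]) : Prop :=
  [/\ continuously_differentiable 3 (fun x => complex.Re (G x)),
      continuously_differentiable 3 (fun x => complex.Im (G x)) &
      bounded_set [set x : R | G x != 0]].

Definition Lp_norm (p : \bar R) (g : R -> R[i]) : \bar R :=
  Lnorm mu p (fun x => (Normc.normc (g x))%:E).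

End Complex_valued_functions.

Section Toeplitz.
Variable R : realType.
Local Notation mu := (@lebesgue_measure R).

Definition period : set R := `[- pi, pi].

Lemma measurable_period : measurable period.
Proof. exact: measurable_itv. Qed.

(** L^oo-norm over [-pi, pi], i.e. the essential supremum of |f| with respect
    to Lebesgue measure restricted to that interval. *)
Definition Linfty_norm (f : R -> R[i]) : \bar R :=
  Lnorm (mrestr mu measurable_period) +oo%E
        (fun x => (Normc.normc (f x))%:E).

(** A function on [-pi, pi] is represented by any extension to [R]; its values
    off the interval are irrelevant. *)
Definition Linfty (f : R -> R[i]) : Prop :=
  cmeasurable period f /\ (Linfty_norm f < +oo)%E.

Definition expi (t : R) : R[i] := cos t +i* sin t.

Definition fourier_coef (f : R -> R[i]) (k : int) : R[i] :=
  ((2 * pi)^-1)%:C * cintegral period (fun x => f x * expi (- (k%:~R * x))).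

(** |||f|||^2, possibly infinite. *)
Definition seminorm_sqr (f : R -> R[i]) : \bar R :=
  (\esum_(k in [set: int])
     ((absz k)%:R * Normc.normc (fourier_coef f k) ^+ 2)%:E)%E.

Definition toeplitz (n : nat) (f : R -> R[i]) : 'M[R[i]]_n :=
  \matrix_(i, j) fourier_coef f (i%:Z - j%:Z).

(** The singular values of [A], with multiplicity and in no particular order:
    the square roots of the eigenvalues of [A^* A]. As [A^* A] is Hermitian,
    [spectral_diag] is the diagonal of a unitary diagonalization of it, with
    real nonnegative entries; taking the real part loses nothing. *)
Definition singular_value (n : nat) (A : 'M[R[i]]_n) (j : 'I_n) : R :=
  Num.sqrt (complex.Re
    (spectral_diag ((map_mx Num.conj A^T) *m A) ord0 j)).

Definition c1 (G : R -> R[i]) : \bar R :=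
  (2%:E * Lp_norm 1 (cderive 1 G)
   + (Num.sqrt 2)%:E * Lp_norm 2%:E (cderive 2 G))%E.

Definition c2 (G : R -> R[i]) : \bar R :=
  (2%:E * Lp_norm 1 (cderive 2 G)
   + (Num.sqrt 2)%:E * Lp_norm 2%:E (cderive 3 G))%E.

End Toeplitz.
Arguments period {R}.

(* Main.v *)
Require Import Defs.
From mathcomp Require Import all_boot all_order all_algebra.
From mathcomp Require Import all_classical all_reals all_analysis.
From mathcomp Require Import complex ring lra zify measurable_realfun.

(** Why the theorem holds.  Write [A] for the [n]-th Toeplitz matrix of [f], [F]
    for the essential supremum of [|f|], [S] for the sum of [|k| |f_k|^2], and
    let [u_j] be an orthonormal basis with [A^h A u_j = s_j u_j], so that the
    [s_j] are the squared singular values.  Let [U_j] be the trigonometric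
    polynomial with coefficient vector [u_j].  As [u] is unitary, the sum of the
    [|U_j|^2] is the constant [n], while each [|U_j|^2] has mean [1]; hence the
    quantity to be bounded is the sum over [j] of the means of
    [|U_j|^2 (G(s_j) - G(|f|^2))].  Taylor's formula for [G] at [s_j] leaves
    two sums to estimate.

    - Linear term.  The mean of [|U_j|^2 (|f|^2 - s_j)] is the squared distance
      from [f U_j] to the span of the characters [0 .. n-1]
      (mean_linear_term), a nonnegative number.  The sum over [j] of these
      distances does not depend on the orthonormal basis, so it is computed on
      the characters: it is [n] times the mean of [|f|^2] minus the sum of the
      [|f_{a-b}|^2], and Parseval's inequality bounds it by [S]
      (sum_truncation_error), since the [k]-th diagonal misses at most [|k|]
      of the [n] rows.

    - Quadratic term.  The row vector of characters multiplied by
      [|f|^2 - A^h A] splits as [conj f * w + w' A], where [w] and [w'] are the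
      residues of multiplication by [f] and by its conjugate (residue_split).
      Both have mean square at most [S], and [|f|] and the norm of [A] are at
      most [F], so the means of [|U_j|^2 (|f|^2 - s_j)^2] add up to at most
      [4 F^2 S] (sum_mean_q).

    Together these give the bound [S (sup |G'| + 2 F^2 sup |G''|)]
    (trace_upper), with suprema over [[0, F^2]].  A function is bounded by its
    [L^1]-norm plus the [L^2]-norm of its derivative, by looking at an interval
    of length one (sup_le_norms); this is applied to the derivatives of the
    real and the imaginary part of [G], and the factor [2] in front of the
    stated bound absorbs the splitting into two parts.

    Parseval's inequality (mean_sqr_le_coefs) rests on the density of
    trigonometric polynomials in mean square among bounded measurable
    functions: indicators of rays are bounded pointwise limits of explicit
    trigonometric polynomials, the Dynkin class theorem extends this to
    measurable sets, and simple functions do the rest. *)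

Set Implicit Arguments.
Unset Strict Implicit.
Unset Printing Implicit Defensive.

Import Order.TTheory GRing.Theory Num.Theory.

Local Open Scope classical_set_scope.
Local Open Scope ring_scope.
Local Notation "x %:C" := (real_complex _ x) (format "x %:C") : ring_scope.
Local Notation "x +i* y" := (Complex x y) : ring_scope.
Local Notation "A ^h" := (map_mx Num.conj A^T) (at level 8, format "A ^h") : ring_scope.

(** * The mean of a bounded measurable function over a period *)

Section Mean.
Variable R : realType.
Local Notation mu := (@lebesgue_measure R).
Implicit Types (h g : R -> R[i]) (u v : R -> R).

(** Boundedness and measurability are required on the whole line, so that the
    class is an algebra and every mean below is an honest integral. *)
Definition rbounded u := measurable_fun setT u /\ exists M, forall x, `|u x| <= M.

Definition cbounded h := rbounded (fun x => complex.Re (h x)) /\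
  rbounded (fun x => complex.Im (h x)).

Lemma rboundedD u v : rbounded u -> rbounded v -> rbounded (fun x => u x + v x).
Proof.
move=> [mu_ [M hM]] [mv [N hN]]; split; first exact: measurable_funD.
by exists (M + N) => x; rewrite (le_trans (ler_normD _ _)) ?lerD.
Qed.

Lemma rboundedM u v : rbounded u -> rbounded v -> rbounded (fun x => u x * v x).
Proof.
move=> [mu_ [M hM]] [mv [N hN]]; split; first exact: measurable_funM.
by exists (M * N) => x; rewrite normrM ler_pM.
Qed.

Lemma rbounded_cst c : rbounded (fun=> c).
Proof. by split; [exact: measurable_cst | exists `|c|]. Qed.

Lemma rboundedN u : rbounded u -> rbounded (fun x => - u x).
Proof.
move=> bu; have := rboundedM (rbounded_cst (-1)) bu.
by under eq_fun do rewrite mulN1r.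
Qed.

Lemma cboundedD h g : cbounded h -> cbounded g -> cbounded (fun x => h x + g x).
Proof.
move=> [h1 h2] [g1 g2]; split.
  by under eq_fun do rewrite raddfD; exact: rboundedD.
by under eq_fun do rewrite raddfD; exact: rboundedD.
Qed.

Lemma cboundedM h g : cbounded h -> cbounded g -> cbounded (fun x => h x * g x).
Proof.
move=> [h1 h2] [g1 g2]; split.
  rewrite (_ : (fun _ => _) = fun x => complex.Re (h x) * complex.Re (g x)
    + - (complex.Im (h x) * complex.Im (g x))).
    by apply: rboundedD; [|apply: rboundedN]; exact: rboundedM.
  by apply/funext => x; case: (h x); case: (g x).
rewrite (_ : (fun _ => _) = fun x => complex.Re (h x) * complex.Im (g x)
    + complex.Im (h x) * complex.Re (g x)).
  by apply: rboundedD; exact: rboundedM.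
by apply/funext => x; case: (h x); case: (g x).
Qed.

Lemma cbounded_cst c : cbounded (fun=> c).
Proof. by split; exact: rbounded_cst. Qed.

Lemma cboundedN h : cbounded h -> cbounded (fun x => - h x).
Proof.
move=> bh; have := cboundedM (cbounded_cst (-1)) bh.
by under eq_fun do rewrite mulN1r.
Qed.

Lemma cboundedB h g : cbounded h -> cbounded g -> cbounded (fun x => h x - g x).
Proof. by move=> bh bg; apply: cboundedD => //; exact: cboundedN. Qed.

Lemma cboundedJ h : cbounded h -> cbounded (fun x => (h x)^*).
Proof.
move=> [h1 h2]; split.
  rewrite (_ : (fun _ => _) = fun x => complex.Re (h x)) //.
  by apply/funext => x; case: (h x).
rewrite (_ : (fun _ => _) = fun x => - complex.Im (h x)); first exact: rboundedN.
by apply/funext => x; case: (h x).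
Qed.

Lemma cbounded_real u : rbounded u -> cbounded (fun x => (u x)%:C).
Proof. by move=> bu; split => //; exact: rbounded_cst. Qed.

Lemma cbounded_sum (I : Type) (r : seq I) (P : pred I) (h : I -> R -> R[i]) :
  (forall i, cbounded (h i)) -> cbounded (fun x => \sum_(i <- r | P i) h i x).
Proof.
move=> bh; elim: r => [|i r IH].
  rewrite (_ : (fun _ => _) = fun=> 0); first exact: cbounded_cst.
  by apply/funext => x; rewrite big_nil.
rewrite (_ : (fun _ => _) = fun x => (if P i then h i x else 0) + \sum_(j <- r | P j) h j x).
  by apply: cboundedD => //; case: (P i) => //; exact: cbounded_cst.
by apply/funext => x; rewrite big_cons; case: ifP => //; rewrite add0r.
Qed.

Lemma cbounded_sqr_norm h : cbounded h -> cbounded (fun x => `|h x| ^+ 2).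
Proof.
move=> bh; under eq_fun do rewrite sqr_normc.
by apply: cboundedM => //; exact: cboundedJ.
Qed.

Lemma mu_period : mu period = (2 * pi)%:E.
Proof.
have pi0 := pi_gt0 R.
rewrite lebesgue_measure_itv/= lte_fin ifT; last by lra.
by rewrite /= opprK -mulr2n mulr_natl.
Qed.

Lemma rbounded_integrable u : rbounded u -> mu.-integrable period (EFin \o u).
Proof.
move=> [mu_ [M hM]]; apply: measurable_bounded_integrable.
- exact: measurable_period.
- by rewrite [X in (X < _)%E]mu_period ltry.
- exact: measurable_funTS.
- exists M; split; first by rewrite num_real.
  by move=> N MN x _ /=; rewrite (le_trans (hM x))// ltW.
Qed.

Definition mean h : R[i] := ((2 * pi)^-1)%:C * cintegral period h.

Lemma meanD h g : cbounded h -> cbounded g ->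
  mean (fun x => h x + g x) = mean h + mean g.
Proof.
move=> [h1 h2] [g1 g2]; rewrite /mean -mulrDr; congr (_ * _).
rewrite /cintegral.
under eq_Rintegral do rewrite raddfD.
under [X in _ +i* X]eq_Rintegral do rewrite raddfD.
rewrite !RintegralD//=; try exact: rbounded_integrable; exact: measurable_period.
Qed.

Lemma meanZ c h : cbounded h -> mean (fun x => c * h x) = c * mean h.
Proof.
move=> [h1 h2]; rewrite /mean mulrCA; congr (_ * _).
have mp := @measurable_period R.
case: c => a b; rewrite /cintegral.
under eq_Rintegral => x _.
  rewrite (_ : complex.Re _ = a * complex.Re (h x) + - b * complex.Im (h x)).
    over.
  by case: (h x) => ? ? /=; rewrite mulNr.
under [X in _ +i* X]eq_Rintegral => x _.
  rewrite (_ : complex.Im _ = a * complex.Im (h x) + b * complex.Re (h x)).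
    over.
  by case: (h x) => ? ? /=.
have i1 := rbounded_integrable h1; have i2 := rbounded_integrable h2.
rewrite !RintegralD//; last first.
- by apply: rbounded_integrable; apply: rboundedM => //; exact: rbounded_cst.
- by apply: rbounded_integrable; apply: rboundedM => //; exact: rbounded_cst.
- by apply: rbounded_integrable; apply: rboundedM => //; exact: rbounded_cst.
- by apply: rbounded_integrable; apply: rboundedM => //; exact: rbounded_cst.
by rewrite !RintegralZl//; simpc.
Qed.

Lemma meanN h : cbounded h -> mean (fun x => - h x) = - mean h.
Proof. by move=> bh; under eq_fun do rewrite -mulN1r; rewrite meanZ// mulN1r. Qed.

Lemma meanB h g : cbounded h -> cbounded g ->
  mean (fun x => h x - g x) = mean h - mean g.
Proof. by move=> bh bg; rewrite meanD ?meanN//; exact: cboundedN. Qed.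

Lemma mean_sum (I : Type) (r : seq I) (P : pred I) (h : I -> R -> R[i]) :
  (forall i, cbounded (h i)) ->
  mean (fun x => \sum_(i <- r | P i) h i x) = \sum_(i <- r | P i) mean (h i).
Proof.
move=> bh; elim: r => [|i r IH].
  rewrite big_nil -[RHS](mul0r (mean (fun=> 0))) -meanZ; last exact: cbounded_cst.
  by congr mean; apply/funext => x; rewrite big_nil mul0r.
rewrite big_cons; case: ifP => Pi; last first.
  by rewrite -IH; congr mean; apply/funext => x; rewrite big_cons Pi.
rewrite -IH -meanD//; last exact: cbounded_sum.
by congr mean; apply/funext => x; rewrite big_cons Pi.
Qed.

Lemma meanJ h : cbounded h -> mean (fun x => (h x)^*) = (mean h)^*.
Proof.
move=> [h1 h2]; rewrite /mean rmorphM [X in _ = X * _]conjc_real; congr (_ * _).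
rewrite /cintegral /=.
have mp := @measurable_period R.
under eq_Rintegral => x _.
  rewrite (_ : complex.Re _ = complex.Re (h x)); last by case: (h x).
  over.
under [X in _ +i* X]eq_Rintegral => x _.
  rewrite (_ : complex.Im _ = -1 * complex.Im (h x)); last by case: (h x) => ? ? /=; rewrite mulN1r.
  over.
by rewrite RintegralZl ?mulN1r//; exact: rbounded_integrable.
Qed.

Lemma mean_real u : mean (fun x => (u x)%:C) =
  ((2 * pi)^-1 * \int[mu]_(x in period) u x)%:C.
Proof.
rewrite /mean /cintegral/= Rintegral_cst; last exact: measurable_period.
by rewrite mul0r; simpc.
Qed.

Lemma mean_cst c : mean (fun=> c) = c.
Proof.
have -> : (fun=> c) = (fun=> c * (1 : R)%:C) :> (R -> R[i]).
  by apply/funext => x; rewrite mulr1.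
rewrite meanZ; last exact: cbounded_cst.
rewrite mean_real Rintegral_cst; last exact: measurable_period.
rewrite mul1r [X in fine X]mu_period/= mulVf ?mulr1//.
by rewrite mulf_neq0// gt_eqF// pi_gt0.
Qed.

Lemma le_mean h g : cbounded h -> cbounded g -> (forall x, h x <= g x) ->
  mean h <= mean g.
Proof.
move=> [h1 h2] [g1 g2] hg; rewrite /mean ler_wpM2l//.
  by rewrite ler0c invr_ge0 mulr_ge0// pi_ge0.
rewrite lecE/=; apply/andP; split.
  apply/eqP/eq_Rintegral => x _.
  by have := hg x; rewrite lecE => /andP[/eqP].
apply: le_Rintegral; [exact: measurable_period|exact: rbounded_integrable..|].
by move=> x _; have := hg x; rewrite lecE => /andP[].
Qed.

End Mean.

(** * Characters and Fourier coefficients *)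

Section Fourier.
Variable R : realType.
Local Notation mu := (@lebesgue_measure R).
Implicit Types (h g : R -> R[i]) (k : int).

Lemma expiD (s t : R) : expi (s + t) = expi s * expi t.
Proof. by rewrite /expi cosD sinD; simpc; congr (_ +i* _); rewrite addrC. Qed.

Lemma expiN (t : R) : expi (- t) = (expi t)^*.
Proof. by rewrite /expi cosN sinN. Qed.

Lemma expi0 : expi 0 = 1 :> R[i].
Proof. by rewrite /expi cos0 sin0. Qed.

Definition fexp k (x : R) : R[i] := expi (k%:~R * x).

Lemma fexpD k l x : fexp (k + l) x = fexp k x * fexp l x.
Proof. by rewrite /fexp intrD mulrDl expiD. Qed.

Lemma fexpN k x : fexp (- k) x = (fexp k x)^*.
Proof. by rewrite /fexp mulrNz mulNr expiN. Qed.

Lemma fexp0 x : fexp 0 x = 1.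
Proof. by rewrite /fexp mul0r expi0. Qed.

Lemma cbounded_fexp k : cbounded (fexp k).
Proof.
have mk : measurable_fun [set: R] (fun x : R => k%:~R * x).
  exact: measurable_funM.
split; split.
- by apply: measurableT_comp mk; apply: continuous_measurable_fun => x; exact: continuous_cos.
- by exists 1 => x; rewrite ler_norml cos_geN1 cos_le1.
- by apply: measurableT_comp mk; apply: continuous_measurable_fun => x; exact: continuous_sin.
- by exists 1 => x; rewrite ler_norml sin_geN1 sin_le1.
Qed.

(** Fundamental theorem of calculus: the form in which characters are shown to
    have mean zero. *)
Lemma Rintegral_period_derive (F u : R -> R) :
  (forall x : R, is_derive x (1 : R) F (u x)) -> continuous u -> F (- pi) = F pi ->
  \int[mu]_(x in period) u x = 0.
Proof.
move=> dF cu FF.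
have pi0 := pi_gt0 R.
rewrite /Rintegral /period (@continuous_FTC2 _ _ F).
- by rewrite FF -EFinB subrr.
- by lra.
- exact: continuous_subspaceT.
- have dF' x : derivable F x 1 by have [] := dF x.
  have cF x : {for x, continuous F} by apply/differentiable_continuous/derivable1_diffP.
  split => //.
  + exact/cvg_at_right_filter/cF.
  + exact/cvg_at_left_filter/cF.
- by move=> x _; rewrite derive1E; have [_] := dF x.
Qed.

Lemma sin_intpi k : sin (k%:~R * pi) = 0 :> R.
Proof.
have sinn (n : nat) : sin (n%:R * pi) = 0 :> R.
  elim: n => [|n IH]; first by rewrite mul0r sin0.
  by rewrite -addn1 natrD mulrDl mul1r sinDpi IH oppr0.
by case: k => n; rewrite ?NegzE ?mulrNz ?mulNr ?sinN sinn ?oppr0.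
Qed.

Lemma mean_fexp k : mean (fexp k) = (k == 0)%:R.
Proof.
have [->|k0] := eqVneq k 0.
  by rewrite -[RHS](mean_cst 1); congr mean; apply/funext => x; rewrite fexp0.
have kR : k%:~R != 0 :> R by rewrite intr_eq0.
have dk (x : R) : is_derive x 1 (fun x : R => k%:~R * x) k%:~R.
  by apply: is_derive_eq; rewrite /GRing.scale/= mulr1.
have ck : continuous (fun x : R => k%:~R * x).
  by move=> x; apply: cvgM; [exact: cvg_cst|exact: cvg_id].
have cos0 : \int[mu]_(x in period) cos (k%:~R * x) = 0.
  apply: (@Rintegral_period_derive (fun x => k%:~R^-1 * sin (k%:~R * x))).
  - move=> x; have d := is_derive1_comp (is_derive_sin (k%:~R * x)) (dk x).
    by apply: is_derive_eq; rewrite /GRing.scale/=; field.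
  - by move=> x; apply: continuous_comp; [exact: ck|exact: continuous_cos].
  - by rewrite mulrN sinN sin_intpi oppr0.
have sin0 : \int[mu]_(x in period) sin (k%:~R * x) = 0.
  apply: (@Rintegral_period_derive (fun x => - k%:~R^-1 * cos (k%:~R * x))).
  - move=> x; have d := is_derive1_comp (is_derive_cos (k%:~R * x)) (dk x).
    by apply: is_derive_eq; rewrite /GRing.scale/=; field.
  - by move=> x; apply: continuous_comp; [exact: ck|exact: continuous_sin].
  - by rewrite mulrN cosN.
by rewrite /mean /cintegral/= cos0 sin0 mulr0.
Qed.

Lemma fourier_coefE h k : fourier_coef h k = mean (fun x => h x * (fexp k x)^*).
Proof.
by rewrite /mean; congr (_ * cintegral _ _); apply/funext => x; rewrite -fexpN /fexp mulrNz mulNr.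
Qed.

Definition trig (I : finType) (kap : I -> int) (c : I -> R[i]) (x : R) : R[i] :=
  \sum_i c i * fexp (kap i) x.

Section Trigonometric_polynomial.
Variables (I : finType) (kap : I -> int) (c : I -> R[i]).
Local Notation p := (trig kap c).

Let bterm i : cbounded (fun x => c i * fexp (kap i) x).
Proof. by apply: cboundedM; [exact: cbounded_cst|exact: cbounded_fexp]. Qed.

Lemma cbounded_trig : cbounded p.
Proof. exact: cbounded_sum. Qed.

Lemma mean_mul_trigJ h : cbounded h ->
  mean (fun x => h x * (p x)^*) = \sum_i (c i)^* * fourier_coef h (kap i).
Proof.
move=> bh.
have bi i : cbounded (fun x => h x * (fexp (kap i) x)^*).
  by apply: cboundedM => //; apply: cboundedJ; exact: cbounded_fexp.
under eq_bigr => i _ do rewrite fourier_coefE -meanZ//.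
rewrite -mean_sum; last first.
  by move=> i; apply: cboundedM => //; exact: cbounded_cst.
congr mean; apply/funext => x; rewrite /trig rmorph_sum mulr_sumr.
by apply: eq_bigr => i _; rewrite rmorphM mulrCA.
Qed.

Lemma fourier_coef_trig : injective kap -> forall i, fourier_coef p (kap i) = c i.
Proof.
move=> kinj i; rewrite fourier_coefE.
rewrite (_ : (fun _ => _) = fun x => \sum_j c j * fexp (kap j - kap i) x).
  rewrite mean_sum => [|j]; last first.
    by apply: cboundedM; [exact: cbounded_cst|exact: cbounded_fexp].
  rewrite (bigD1 i)//= big1 => [|j ji].
    by rewrite meanZ ?mean_fexp ?subrr ?eqxx ?mulr1 ?addr0//; exact: cbounded_fexp.
  rewrite meanZ ?mean_fexp ?subr_eq0 ?(inj_eq kinj) ?(negbTE ji) ?mulr0//.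
  exact: cbounded_fexp.
apply/funext => x; rewrite mulr_suml; apply: eq_bigr => j _.
by rewrite fexpD fexpN mulrA.
Qed.

(** Pythagoras: the Fourier coefficients are the coordinates of the orthogonal
    projection of [h] onto the span of the characters [kap i].  Bessel's
    inequality, Parseval's inequality and the exact size of a truncation error
    are all read off from this identity. *)
Lemma mean_sqr_dist h : injective kap -> cbounded h ->
  mean (fun x => `|h x - p x| ^+ 2) =
  mean (fun x => `|h x| ^+ 2) - \sum_i `|fourier_coef h (kap i)| ^+ 2
    + \sum_i `|c i - fourier_coef h (kap i)| ^+ 2.
Proof.
move=> kinj bh; have bp := cbounded_trig.
have bhp : cbounded (fun x => h x * (p x)^*) by apply: cboundedM => //; exact: cboundedJ.
have bpp : cbounded (fun x => p x * (p x)^*) by apply: cboundedM => //; exact: cboundedJ.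
have bph : cbounded (fun x => p x * (h x)^*) by apply: cboundedM => //; exact: cboundedJ.
rewrite (_ : (fun x => `|h x - p x| ^+ 2) = fun x =>
    `|h x| ^+ 2 - h x * (p x)^* - p x * (h x)^* + p x * (p x)^*); last first.
  by apply/funext => x; rewrite !normCK rmorphB; ring.
have bh2 := cbounded_sqr_norm bh.
rewrite meanD ?meanB//; [|by do ?apply: cboundedB..].
have -> : mean (fun x => p x * (h x)^*) = (mean (fun x => h x * (p x)^*))^*.
  by rewrite -meanJ//; congr mean; apply/funext => x; rewrite rmorphM/= conjCK mulrC.
rewrite !mean_mul_trigJ// rmorph_sum -!addrA; congr (_ + _).
rewrite -!sumrN -!big_split/=; apply: eq_bigr => i _.
by rewrite fourier_coef_trig// !normCK rmorphB rmorphM/= conjCK; ring.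
Qed.

End Trigonometric_polynomial.

Lemma bessel (I : finType) (kap : I -> int) h : injective kap -> cbounded h ->
  \sum_i `|fourier_coef h (kap i)| ^+ 2 <= mean (fun x => `|h x| ^+ 2).
Proof.
move=> kinj bh.
have := mean_sqr_dist (fun i => fourier_coef h (kap i)) kinj bh.
rewrite [X in _ + X]big1 => [|i _]; last by rewrite subrr normr0 expr0n.
rewrite addr0 -subr_ge0 => <-; rewrite -(mean_cst 0).
apply: le_mean => [||x]; [exact: cbounded_cst| |exact: exprn_ge0].
by apply: cbounded_sqr_norm; apply: cboundedB => //; exact: cbounded_trig.
Qed.

End Fourier.

(** * Density of trigonometric polynomials in mean square *)

Section Step.
Variable R : realType.
Implicit Types (x y z t r : R).

Lemma bernoulli_ge y n : -1 <= y -> 1 + n%:R * y <= (1 + y) ^+ n.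
Proof.
move=> y1; elim: n => [|n IH]; first by rewrite expr0 mul0r addr0.
have y0 : 0 <= 1 + y by lra.
rewrite exprS; apply: le_trans (ler_wpM2l y0 IH).
have : 0 <= n%:R * y ^+ 2 by rewrite mulr_ge0// sqr_ge0.
by rewrite -natr1; nra.
Qed.

Lemma cvg_nat_geometric r : 0 <= r < 1 -> (fun n => n%:R * r ^+ n) @ \oo --> 0.
Proof.
move=> /andP[r0 r1]; set s := Num.sqrt r.
have s0 : 0 <= s by exact: sqrtr_ge0.
have s1 : s < 1 by rewrite -sqrtr1 ltr_sqrt.
have bnd n : n%:R * s ^+ n * (1 - s) + s ^+ n <= 1.
  elim: n => [|n IH]; first by rewrite !mul0r add0r.
  have h1 := ler_wpM2l s0 IH.
  have h2 : 0 <= (1 - s ^+ n.+1) * (1 - s).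
    by rewrite mulr_ge0// subr_ge0 ?exprn_ile1// ltW.
  by move: h1 h2; rewrite exprS -natr1; lra.
apply: (@squeeze_cvgr _ _ _ _ (fun=> 0) (geometric (1 - s)^-1 s)).
- near=> n; rewrite mulr_ge0//= ?exprn_ge0//.
  rewrite [leRHS]mulrC ler_pdivlMr ?subr_gt0// -(sqr_sqrtr r0) -exprM mulnC exprM expr2.
  have a0 : 0 <= s ^+ n by rewrite exprn_ge0.
  have : 0 <= s ^+ n * (1 - (n%:R * s ^+ n * (1 - s) + s ^+ n)).
    by rewrite mulr_ge0// subr_ge0.
  by have : 0 <= s ^+ n * s ^+ n; [exact: mulr_ge0|rewrite -/s; lra].
- exact: cvg_cst.
- by apply: cvg_geometric; rewrite ger0_norm.
Unshelve. all: by end_near. Qed.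

(** Polynomials in [z] converging to the indicator of [z < 1/2] on [[0, 1]].
    With [y = z ^ n], Bernoulli's inequality bounds [(1 - y) ^ m] below by
    [1 - m y] and above by [1 / (1 + m y)], where [m y = n (2 z) ^ n] tends to
    [0] or to infinity.  The factor [n] in the exponent [m = n 2 ^ n] settles
    the threshold [z = 1/2], where [m y = n]. *)
Lemma cvg_step z : 0 <= z <= 1 ->
  (fun n => (1 - z ^+ n) ^+ (n * 2 ^ n)) @ \oo --> ((z < 2^-1%R)%R%:R : R).
Proof.
move=> /andP[z0 z1].
have zn n : 0 <= z ^+ n <= 1 by rewrite exprn_ge0// exprn_ile1.
case: ltP => hz.
  apply: (@squeeze_cvgr _ _ _ _ (fun n => 1 - n%:R * (2 * z) ^+ n) (fun=> 1)).
  - near=> n; have /andP[a0 a1] := zn n.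
    rewrite exprn_ile1 ?andbT; [|lra..].
    have := @bernoulli_ge (- z ^+ n) (n * 2 ^ n); rewrite lerN2 => /(_ a1).
    by rewrite natrM natrX exprMn mulrN mulrA.
  - rewrite -[X in _ --> X]subr0; apply: cvgB; first exact: cvg_cst.
    by apply: cvg_nat_geometric; lra.
  - exact: cvg_cst.
apply: (@squeeze_cvgr _ _ _ _ (fun=> 0) (fun n => n.+1%:R^-1)).
- near=> n; have /andP[a0 a1] := zn n.
  rewrite exprn_ge0 ?subr_ge0//=.
  set y := z ^+ n in a0 a1 *; set m := (n * 2 ^ n)%N.
  have my : n%:R <= m%:R * y.
    rewrite /m natrM natrX -mulrA -exprMn ler_peMr// exprn_ege1//; lra.
  have h : 1 + m%:R * y <= (1 + y) ^+ m by apply: bernoulli_ge; lra.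
  have p1 : (1 - y) ^+ m * (1 + y) ^+ m <= 1.
    by rewrite -exprMn exprn_ile1//; nra.
  rewrite -[leRHS]mul1r ler_pdivlMr ?ltr0n// (le_trans _ p1)// ler_wpM2l ?exprn_ge0 ?subr_ge0//.
  by rewrite -natr1; lra.
- exact: cvg_cst.
- exact: cvg_harmonic.
Unshelve. all: by end_near. Qed.

End Step.

Lemma normD_sqr_le (C : numClosedFieldType) (a b : C) :
  `|a + b| ^+ 2 <= 2 * `|a| ^+ 2 + 2 * `|b| ^+ 2.
Proof.
rewrite -subr_ge0 (_ : _ - _ = `|a - b| ^+ 2) ?exprn_ge0//.
by rewrite !normCK rmorphB rmorphD/=; ring.
Qed.

Section Density.
Variable R : realType.
Implicit Types (h g p q : R -> R[i]) (u v : R -> R).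

(** Encoded as a power of the character [1] times a polynomial in it, which
    makes closure under products immediate. *)
Definition trigpoly p := exists (N : nat) (Q : {poly R[i]}),
  forall x, p x = fexp (- N%:Z) x * Q.[fexp 1 x].

Lemma fexp_nat (n : nat) (x : R) : fexp n x = fexp 1 x ^+ n.
Proof.
elim: n => [|n IH]; first by rewrite fexp0.
by rewrite -addn1 PoszD fexpD IH exprD.
Qed.

Lemma trigpoly_cst c : trigpoly (fun=> c).
Proof. by exists 0%N, c%:P => x; rewrite hornerC fexp0 mul1r. Qed.

Lemma trigpolyM p q : trigpoly p -> trigpoly q -> trigpoly (fun x => p x * q x).
Proof.
move=> [N [P hp]] [M [Q hq]]; exists (N + M)%N, (P * Q) => x.
by rewrite hp hq hornerM PoszD opprD fexpD mulrACA.
Qed.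

Lemma trigpolyD p q : trigpoly p -> trigpoly q -> trigpoly (fun x => p x + q x).
Proof.
move=> [N [P hp]] [M [Q hq]]; exists (N + M)%N, ('X^M * P + 'X^N * Q) => x.
rewrite hp hq !hornerE mulrDr !mulrA -!fexp_nat -!fexpD.
by congr (fexp _ x * _ + fexp _ x * _); lia.
Qed.

Lemma trigpoly_fexp k : trigpoly (fexp k).
Proof.
case: k => n.
  by exists 0%N, 'X^n => x; rewrite !hornerE -fexp_nat fexp0 mul1r.
by exists n.+1, 1 => x; rewrite hornerE mulr1 NegzE.
Qed.

Lemma trigpolyN p : trigpoly p -> trigpoly (fun x => - p x).
Proof.
move=> tp; rewrite (_ : (fun x => _) = fun x => -1 * p x).
  by apply: trigpolyM => //; exact: trigpoly_cst.
by apply/funext => x; rewrite mulN1r.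
Qed.

Lemma trigpolyX p n : trigpoly p -> trigpoly (fun x => p x ^+ n).
Proof.
move=> tp; elim: n => [|n IH]; first exact: trigpoly_cst.
rewrite (_ : (fun x => _) = fun x => p x * p x ^+ n); first exact: trigpolyM.
by apply/funext => x; rewrite exprS.
Qed.

Lemma expiDJ (t : R) : expi t + (expi t)^* = 2 * (cos t)%:C.
Proof.
rewrite mulr_natl mulr2n; apply/eqP; rewrite eq_complex/=.
by rewrite subrr addr0 !eqxx.
Qed.

Lemma trigpoly_cos (a : R) : trigpoly (fun x => (cos (x - a))%:C).
Proof.
rewrite (_ : (fun x => _) = fun x =>
    2^-1 * (fexp 1 x * expi (- a) + fexp (- (1)) x * expi a)); last first.
  apply/funext => x; rewrite /fexp !mulrNz !mulr1z mulN1r mul1r -!expiD.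
  rewrite (_ : - x + a = - (x - a)); last by ring.
  by rewrite expiN expiDJ mulKf// pnatr_eq0.
apply: trigpolyM; first exact: trigpoly_cst.
by apply: trigpolyD; apply: trigpolyM;
  do [exact: trigpoly_fexp|exact: trigpoly_cst].
Qed.

Lemma trigpoly_trig p : trigpoly p -> exists (m : nat) (kap : 'I_m -> int) c,
  injective kap /\ p = trig kap c.
Proof.
move=> [N [Q hp]]; exists (size Q), (fun i : 'I__ => i%:Z - N%:Z), (fun i : 'I__ => Q`_i); split.
  by move=> i j /addIr[] /val_inj.
apply/funext => x; rewrite hp horner_coef mulr_sumr; apply: eq_bigr => i _.
by rewrite fexpD fexp_nat mulrC mulrA.
Qed.

Lemma cbounded_trigpoly p : trigpoly p -> cbounded p.
Proof. by move=> /trigpoly_trig[m [kap [c [_ ->]]]]; exact: cbounded_trig. Qed.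

(** Membership in the mean-square closure of the trigonometric polynomials. *)
Definition trig_approx h := forall e : R, 0 < e -> exists p, trigpoly p /\
  mean (fun x => `|h x - p x| ^+ 2) <= e%:C.

Lemma trigpoly_approx p : trigpoly p -> trig_approx p.
Proof.
move=> tp e e0; exists p; split => //.
rewrite (_ : (fun x => _) = fun=> 0); last first.
  by apply/funext => x; rewrite subrr normr0 expr0n.
by rewrite mean_cst ler0c ltW.
Qed.

Lemma mean_normD_sqr_le h g : cbounded h -> cbounded g ->
  mean (fun x => `|h x + g x| ^+ 2) <=
  2 * mean (fun x => `|h x| ^+ 2) + 2 * mean (fun x => `|g x| ^+ 2).
Proof.
move=> bh bg.
have bh2 := cbounded_sqr_norm bh; have bg2 := cbounded_sqr_norm bg.
have b2 := cbounded_cst (2 : R[i]).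
rewrite -!meanZ// -meanD; [|exact: cboundedM..].
apply: le_mean => [||x]; last exact: normD_sqr_le.
  by apply: cbounded_sqr_norm; exact: cboundedD.
by apply: cboundedD; exact: cboundedM.
Qed.

Let quarters (e : R) : e%:C = 2 * (e / 4)%:C + 2 * (e / 4)%:C.
Proof.
rewrite -mulrDr -rmorphD/= -[2]/(2%:R) -(rmorph_nat (real_complex R)) -rmorphM/=.
by congr (_%:C); field.
Qed.

Lemma trig_approx_closed h : cbounded h ->
  (forall e : R, 0 < e -> exists g, [/\ cbounded g, trig_approx g &
    mean (fun x => `|h x - g x| ^+ 2) <= e%:C]) -> trig_approx h.
Proof.
move=> bh H e e0; have e4 : 0 < e / 4 by rewrite divr_gt0.
have [g [bg ag hg]] := H _ e4; have [p [tp gp]] := ag _ e4.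
exists p; split => //; have bp := cbounded_trigpoly tp.
rewrite (_ : (fun x => _) = fun x => `|(h x - g x) + (g x - p x)| ^+ 2); last first.
  by apply/funext => x; rewrite addrA subrK.
apply: le_trans (mean_normD_sqr_le _ _) _; try exact: cboundedB.
by rewrite [leRHS]quarters; apply: lerD; rewrite ler_pM2l ?ltr0n.
Qed.

Lemma trig_approxD h g : cbounded h -> cbounded g ->
  trig_approx h -> trig_approx g -> trig_approx (fun x => h x + g x).
Proof.
move=> bh bg ah ag e e0; have e4 : 0 < e / 4 by rewrite divr_gt0.
have [p [tp hp]] := ah _ e4; have [q [tq gq]] := ag _ e4.
exists (fun x => p x + q x); split; first exact: trigpolyD.
have bp := cbounded_trigpoly tp; have bq := cbounded_trigpoly tq.
rewrite (_ : (fun x => _) = fun x => `|(h x - p x) + (g x - q x)| ^+ 2); last first.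
  by apply/funext => x; rewrite opprD addrACA.
apply: le_trans (mean_normD_sqr_le _ _) _; try exact: cboundedB.
by rewrite [leRHS]quarters; apply: lerD; rewrite ler_pM2l ?ltr0n.
Qed.

Lemma trig_approxZ c h : cbounded h -> trig_approx h ->
  trig_approx (fun x => c * h x).
Proof.
move=> bh ah e e0; set d := (Normc.normc c) ^+ 2.
have d0 : 0 <= d by exact: sqr_ge0.
have de : 0 < e / (d + 1) by rewrite divr_gt0// ltr_wpDl.
have [p [tp hp]] := ah _ de; exists (fun x => c * p x); split.
  by apply: trigpolyM => //; exact: trigpoly_cst.
have bp := cbounded_trigpoly tp.
rewrite (_ : (fun x => _) = fun x => `|c| ^+ 2 * `|h x - p x| ^+ 2); last first.
  by apply/funext => x; rewrite -mulrBr normrM exprMn.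
rewrite meanZ; last by apply: cbounded_sqr_norm; exact: cboundedB.
apply: le_trans (ler_wpM2l _ hp) _; first exact: exprn_ge0.
rewrite (_ : `|c| ^+ 2 = d%:C); last by rewrite /d rmorphXn.
rewrite -rmorphM/= lecR mulrCA ger_pMr// ler_pdivrMr ?ltr_wpDl// mul1r lerDl.
exact: ler01.
Qed.

End Density.

Section Completeness.
Variable R : realType.
Local Notation mu := (@lebesgue_measure R).
Implicit Types (h g : R -> R[i]) (u v : R -> R).

Lemma Rintegral_period_oc u : rbounded u ->
  \int[mu]_(x in period) u x = \int[mu]_(x in `]- pi, pi]) u x.
Proof.
move=> bu; rewrite Rintegral_itv_obnd_cbnd//.
apply: integrableS (rbounded_integrable bu) => //.
  exact: measurable_period.
exact: subset_itv_oc_cc.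
Qed.

(** Convergence is only required off the endpoint [- pi]: the trigonometric
    polynomials are [2 pi]-periodic and cannot separate it from [pi]. *)
Lemma bounded_convergence (u_ : nat -> R -> R) u M :
  (forall n, measurable_fun setT (u_ n)) -> measurable_fun setT u ->
  (forall n x, `|u_ n x| <= M) -> (forall x, `|u x| <= M) ->
  (forall x, x \in `]- pi, pi] -> u_ ^~ x @ \oo --> u x) ->
  forall e : R, 0 < e -> exists n,
    mean (fun x => `|(u x)%:C - (u_ n x)%:C| ^+ 2) <= e%:C.
Proof.
move=> mu_n mu_ bu_ bu cu e e0.
set D := `]- pi, pi]%classic : set R.
have mD : measurable D by exact: measurable_itv.
have pi0 := pi_gt0 R.
have bd n : rbounded (fun x => (u x - u_ n x) ^+ 2).
  split; first by apply: measurable_funX; exact: measurable_funB.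
  exists ((M + M) ^+ 2) => x; rewrite normrX ler_sqr ?nnegrE//.
    by rewrite (le_trans (ler_normB _ _))// lerD.
  by rewrite addr_ge0// (le_trans _ (bu 0)).
pose F n := (\int[mu]_(x in D) ((u x - u_ n x) ^+ 2)%:E)%E.
have F0 : F @ \oo --> (\int[mu]_(x in D) 0%:E)%E.
  refine (@dominated_cvg _ _ R mu D mD (fun n x => ((u x - u_ n x) ^+ 2)%:E)
    (fun=> 0%:E) (fun=> ((M + M) ^+ 2)%:E) _ _ _ _ _).
  - move=> n; apply/measurable_EFinP; apply: measurable_funTS.
    by have [] := bd n.
  - move=> x Dx; apply: cvg_EFin; first by near=> n.
    rewrite (_ : 0 = (u x - u x) ^+ 2); last by rewrite subrr expr0n.
    apply: cvgM; (apply: cvgB; [exact: cvg_cst|]); apply: cu;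
      by move: Dx; rewrite /D/= in_itv.
  - by [].
  - apply: integrableS (rbounded_integrable (rbounded_cst ((M + M) ^+ 2))) => //.
      exact: measurable_period.
    exact: subset_itv_oc_cc.
  - move=> n x _; rewrite /= lee_fin normrX ler_sqr ?nnegrE//.
      by rewrite (le_trans (ler_normB _ _))// lerD.
    by rewrite addr_ge0// (le_trans _ (bu 0)).
rewrite integral0 in F0.
have /fine_cvg /cvgr_lt /(_ (2 * pi * e)) := F0.
have -> : 0 < 2 * pi * e by rewrite !mulr_gt0.
move=> /(_ isT) [n _ /(_ n (leqnn n))]/= Fn.
exists n; rewrite (_ : (fun x => _) = fun x => ((u x - u_ n x) ^+ 2)%:C); last first.
  apply/funext => x; rewrite -rmorphB/= -add_Re2_Im2/= [X in _ + X]expr0n/= addr0//.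
rewrite mean_real lecR ler_pdivrMl ?mulr_gt0//.
rewrite Rintegral_period_oc//; exact: ltW.
Unshelve. all: by end_near. Qed.

Definition rtrig_approx u := trig_approx (fun x => (u x)%:C).

Lemma rtrig_approx_cvg (u_ : nat -> R -> R) u M :
  (forall n, measurable_fun setT (u_ n)) -> measurable_fun setT u ->
  (forall n x, `|u_ n x| <= M) -> (forall x, `|u x| <= M) ->
  (forall x, x \in `]- pi, pi] -> u_ ^~ x @ \oo --> u x) ->
  (forall n, rtrig_approx (u_ n)) -> rtrig_approx u.
Proof.
move=> mu_n mu_ bu_ bu cu au; apply: trig_approx_closed.
  by apply: cbounded_real; split => //; exists M.
move=> e e0; have [n hn] := bounded_convergence mu_n mu_ bu_ bu cu e0.
exists (fun x => (u_ n x)%:C); split => //; last exact: au.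
by apply: cbounded_real; split => //; exists M.
Qed.

Lemma rtrig_approxD u v : rbounded u -> rbounded v ->
  rtrig_approx u -> rtrig_approx v -> rtrig_approx (fun x => u x + v x).
Proof.
move=> bu bv au av; rewrite /rtrig_approx.
rewrite (_ : (fun x => _) = fun x => (u x)%:C + (v x)%:C); last first.
  by apply/funext => x; rewrite rmorphD.
by apply: trig_approxD => //; exact: cbounded_real.
Qed.

Lemma rtrig_approxZ c u : rbounded u ->
  rtrig_approx u -> rtrig_approx (fun x => c * u x).
Proof.
move=> bu au; rewrite /rtrig_approx.
rewrite (_ : (fun x => _) = fun x => c%:C * (u x)%:C); last first.
  by apply/funext => x; rewrite rmorphM.
by apply: trig_approxZ => //; exact: cbounded_real.
Qed.

Lemma rtrig_approx_cst c : rtrig_approx (fun=> c).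
Proof. by apply: trigpoly_approx; exact: trigpoly_cst. Qed.

(** The ray from [t] meets the period in an arc of the circle with midpoint
    [(t + pi) / 2] and half-length [(pi - t) / 2], on which the cosine of the
    distance to the midpoint is large. *)
Lemma cos_arc (t x : R) : - pi < t <= pi -> - pi < x <= pi ->
  (cos (x - (t + pi) / 2) < cos ((pi - t) / 2)) = (x < t).
Proof.
move=> /andP[t0 t1] /andP[x0 x1]; have pi0 := pi_gt0 R.
set a := (t + pi) / 2; set b := (pi - t) / 2.
have bI : b \in `[0, pi] by rewrite in_itv/=; apply/andP; rewrite /b; lra.
have [xa|ax] := leP a x.
  rewrite ltr_cos//; last by rewrite in_itv/=; apply/andP; rewrite /a in xa *; lra.
  by apply/idP/idP; rewrite /a /b in xa *; lra.
rewrite -cosN opprB; have [axpi|axpi] := leP (a - x) pi.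
  rewrite ltr_cos//; last by rewrite in_itv/=; apply/andP; rewrite /a in ax axpi *; lra.
  by apply/idP/idP; rewrite /a /b in ax axpi *; lra.
rewrite -(cosN (a - x)) -(cosD2pi (- (a - x))) ltr_cos//; last first.
  by rewrite in_itv/= mulr2n; apply/andP; rewrite /a in ax axpi *; lra.
by rewrite mulr2n; apply/idP/idP; rewrite /a /b in ax axpi *; lra.
Qed.

Lemma rbounded_indic (S : set R) : measurable S -> rbounded (\1_S : R -> R).
Proof.
move=> mS; split; first exact: measurable_indic.
by exists 1 => x; rewrite indicE ger0_norm// lern1 leq_b1.
Qed.

Lemma rtrig_approx_ray (t : R) : rtrig_approx (\1_(`[t, +oo[%classic)).
Proof.
have pi0 := pi_gt0 R.
have mI : measurable (`[t, +oo[%classic : set R) by exact: measurable_itv.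
have [mi _] := rbounded_indic mI.
have bi x : `|\1_(`[t, +oo[%classic) x : R| <= 1.
  by rewrite indicE ger0_norm// lern1 leq_b1.
have [tpi|tpi] := leP t (- pi).
  apply: (@rtrig_approx_cvg (fun _ => cst 1) _ 1) => //.
  - by move=> n x; rewrite normr1.
  - move=> x; rewrite in_itv/= => /andP[x0 _].
    rewrite indicE mem_set; last by rewrite /= in_itv/= andbT (le_trans tpi)// ltW.
    exact: cvg_cst.
  - by move=> n; exact: rtrig_approx_cst.
have [pit|tpi1] := ltP pi t.
  apply: (@rtrig_approx_cvg (fun _ => cst 0) _ 1) => //.
  - by move=> n x; rewrite normr0.
  - move=> x; rewrite in_itv/= => /andP[_ x0].
    rewrite indicE memNset; first exact: cvg_cst.
    by rewrite /= in_itv/= andbT => tx; have := lt_le_trans pit (le_trans tx x0); rewrite ltxx.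
  - by move=> n; exact: rtrig_approx_cst.
(* [z] is affine in the cosine, takes its values in [[0, 1]] and crosses [1/2]
   exactly at the end of the arc. *)
pose z x := 2^-1 + (cos (x - (t + pi) / 2) - cos ((pi - t) / 2)) / 4.
have z01 x : 0 <= z x <= 1.
  have := cos_geN1 (x - (t + pi) / 2); have := cos_le1 (x - (t + pi) / 2).
  have := cos_geN1 ((pi - t) / 2); have := cos_le1 ((pi - t) / 2).
  by rewrite /z; lra.
have p01 x n m : 0 <= (1 - z x ^+ n) ^+ m <= 1.
  have /andP[z0 z1] := z01 x; have /andP[a0 a1] : 0 <= z x ^+ n <= 1.
    by rewrite exprn_ge0// exprn_ile1.
  by rewrite exprn_ge0 ?subr_ge0// exprn_ile1//; lra.
have tz : trigpoly (fun x => (z x)%:C).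
  rewrite (_ : (fun x => _) = fun x => (2^-1 - cos ((pi - t) / 2) / 4)%:C +
      (4^-1)%:C * (cos (x - (t + pi) / 2))%:C); last first.
    by apply/funext => x; rewrite -rmorphM -rmorphD/=; congr (_%:C); rewrite /z; field.
  apply: trigpolyD; first exact: trigpoly_cst.
  by apply: trigpolyM; [exact: trigpoly_cst|exact: trigpoly_cos].
have mz : measurable_fun setT z by have [[]] := cbounded_trigpoly tz.
apply: (@rtrig_approx_cvg (fun n x => 1 - (1 - z x ^+ n) ^+ (n * 2 ^ n)) _ 1) => //.
- move=> n; apply: measurable_funB => //; apply: measurable_funX.
  by apply: measurable_funB => //; exact: measurable_funX.
- move=> n x; have /andP[] := p01 x n (n * 2 ^ n)%N.
  by move=> ? ?; rewrite ger0_norm; lra.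
- move=> x xD; rewrite (_ : \1__ x = 1 - (z x < 2^-1)%R%:R).
    by apply: cvgB; [exact: cvg_cst|exact: cvg_step].
  rewrite (_ : (_ < _) = (x < t)); last first.
    have xI : - pi < x <= pi by move: xD; rewrite in_itv.
    have tI : - pi < t <= pi by rewrite tpi.
    rewrite -(cos_arc tI xI).
    by rewrite /z; apply/idP/idP; lra.
  rewrite indicE mem_setE/= in_itv/= andbT.
  by case: ltP; rewrite ?subrr ?subr0.
- move=> n; apply: trigpoly_approx.
  rewrite (_ : (fun x => _) = fun x => 1 + - ((1 + - (z x)%:C ^+ n) ^+ (n * 2 ^ n))).
    apply: trigpolyD; first exact: trigpoly_cst.
    apply/trigpolyN/trigpolyX; apply: trigpolyD; first exact: trigpoly_cst.
    exact/trigpolyN/trigpolyX.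
  by apply/funext => x; rewrite -rmorphXn -rmorphB -rmorphXn -rmorphB.
Qed.

(** Rays form a pi-system generating the Borel sets, and the sets whose
    indicator can be approximated form a Dynkin class. *)
Lemma rtrig_approx_indic (S : set R) : measurable S -> rtrig_approx (\1_S).
Proof.
have bI A : forall x, `|\1_A x : R| <= 1.
  by move=> x; rewrite indicE ger0_norm// lern1 leq_b1.
move=> mS; suff [] : measurable S /\ rtrig_approx (\1_S) by [].
have mE : measurable = <<s @RGenCInfty.G R >> by exact: RGenCInfty.measurableE.
have IH : setI_closed (@RGenCInfty.G R).
  move=> A B [a ->] [b ->]; exists (Num.max a b).
  apply/seteqP; split=> x /=; rewrite !in_itv/= !andbT ge_max.
    by move=> [-> ->].
  by move=> /andP[-> ->].
refine (@dynkin_induction _ _ (@RGenCInfty.G R)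
  (fun S => measurable S /\ rtrig_approx (\1_S)) mE IH _ _ _ _ S _).
- split; first exact: measurableT.
  by rewrite indicT; exact: rtrig_approx_cst.
- by move=> A [a ->]; split; [exact: measurable_itv|exact: rtrig_approx_ray].
- move=> A mA [_ aA]; split; first exact: measurableC.
  rewrite (_ : \1_(~` A) = fun x => 1 + -1 * \1_A x).
    apply: rtrig_approxD.
    + exact: rbounded_cst.
    + apply: rboundedM; [exact: rbounded_cst|exact: rbounded_indic].
    + exact: rtrig_approx_cst.
    + by apply: rtrig_approxZ => //; exact: rbounded_indic.
  by apply/funext => x; rewrite !indicE in_setC mulN1r; case: (_ \in A); rewrite ?subrr ?subr0.
- move=> F mF tF aF; split; first exact: bigcupT_measurable.
  have mU n : measurable (\big[setU/set0]_(k < n) F k).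
    exact: bigsetU_measurable.
  apply: (@rtrig_approx_cvg (fun n => \1_(\big[setU/set0]_(k < n) F k)) _ 1) => //.
  + by apply: measurable_indic; exact: bigcupT_measurable.
  + move=> x _; rewrite indicE; case: (boolP (x \in _)) => xF.
      have [k _ Fkx] : (\bigcup_k F k) x by rewrite inE in xF.
      apply: cvg_near_cst; exists k.+1 => // n /= kn.
      by rewrite indicE mem_set// -bigcup_mkord; exists k.
    rewrite (_ : (fun _ => _) = fun=> 0); first exact: cvg_cst.
    apply/funext => n; rewrite indicE memNset// -bigcup_mkord => -[k _ Fkx].
    by move: xF; rewrite notin_setE; apply; exists k.
  + elim=> [|n IHn].
      by rewrite big_ord0 indic0; exact: rtrig_approx_cst.
    rewrite big_ord_recr/= (_ : \1__ = fun x =>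
        \1_(\big[setU/set0]_(k < n) F k) x + \1_(F n) x).
      apply: rtrig_approxD => //; try exact: rbounded_indic.
      by have [] := aF n.
    apply/funext => x; rewrite !indicE in_setU.
    case: (boolP (x \in F n)) => xn; last by rewrite orbF addr0.
    rewrite orbT memNset ?add0r// -bigcup_mkord => -[k /= kn Fkx].
    rewrite inE in xn.
    have /trivIsetP/(_ k n Logic.I Logic.I) := tF.
    by rewrite ltn_eqF// => /(_ isT)/seteqP[+ _] => /(_ x); apply.
- by rewrite -mE.
Qed.

Import HBNNSimple.

Lemma rbounded_trig_approx u : rbounded u -> rtrig_approx u.
Proof.
move=> bu; have [mu_ [M hM]] := bu.
suff H v : rbounded v -> (forall x, 0 <= v x) -> rtrig_approx v.
  have buM : rbounded (fun x => u x + M).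
    by apply: rboundedD => //; exact: rbounded_cst.
  rewrite (_ : u = fun x => (u x + M) + - M); last by apply/funext => x; rewrite addrK.
  apply: rtrig_approxD => //; [exact: rbounded_cst| |exact: rtrig_approx_cst].
  by apply: H => // x; have := hM x; rewrite ler_norml => /andP[]; lra.
move=> [mv [N hN]] v0.
have mEv : measurable_fun setT (EFin \o v) by exact/measurable_EFinP.
have v0E x : setT x -> (0 <= (EFin \o v) x)%E by rewrite /= lee_fin.
pose s n := nnsfun_approx measurableT mEv n.
have bs n x : `|s n x| <= N.
  rewrite ger0_norm// -lee_fin (@le_trans _ _ (v x)%:E)//.
    by rewrite /s nnsfun_approxE (le_approx n v0E).
  by rewrite lee_fin (le_trans (ler_norm _)).
apply: (@rtrig_approx_cvg (fun n x => s n x) v N) => //.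
- by move=> x _; have /fine_cvg := cvg_nnsfun_approx measurableT mEv v0E (I : setT x).
- move=> n; have ms y : measurable (s n @^-1` [set y]) by exact: measurable_sfunP.
  have b1 y : rbounded (fun x => y * \1_(s n @^-1` [set y]) x).
    by apply: rboundedM; [exact: rbounded_cst|exact: rbounded_indic].
  suff H (r : seq R) : let w x := \sum_(y <- r) y * \1_(s n @^-1` [set y]) x in
      rbounded w /\ rtrig_approx w.
    have [_] := H (finmap.enum_fset (fset_set (range (s n)))).
    congr rtrig_approx; apply/funext => x.
    by rewrite fimfunE fsbig_finite.
  elim: r => [|y r [IHb IHa]] /=.
    rewrite (_ : (fun x => _) = fun=> 0); last by apply/funext => x; rewrite big_nil.
    by split; [exact: rbounded_cst|exact: rtrig_approx_cst].
  rewrite (_ : (fun x => _) = fun x => y * \1_(s n @^-1` [set y]) x +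
      \sum_(y <- r) y * \1_(s n @^-1` [set y]) x); last first.
    by apply/funext => x; rewrite big_cons.
  split; first exact: rboundedD.
  apply: rtrig_approxD => //; apply: rtrig_approxZ; first exact: rbounded_indic.
  exact: rtrig_approx_indic.
Qed.

Lemma cbounded_trig_approx h : cbounded h -> trig_approx h.
Proof.
move=> [h1 h2]; rewrite (_ : h = fun x => (complex.Re (h x))%:C + 'i%C * (complex.Im (h x))%:C).
  apply: trig_approxD; first exact: cbounded_real.
  - by apply: cboundedM; [exact: cbounded_cst|exact: cbounded_real].
  - exact: rbounded_trig_approx.
  - by apply: trig_approxZ; [exact: cbounded_real|exact: rbounded_trig_approx].
by apply/funext => x; rewrite -complexE.
Qed.

(** Parseval's inequality.  An error [e] and an unspecified finite set of
    frequencies spare the summation of a series; the arbitrary [e] disappears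
    once only finite sums of coefficients are compared. *)
Lemma mean_sqr_le_coefs h (e : R) : cbounded h -> 0 < e ->
  exists (m : nat) (kap : 'I_m -> int), injective kap /\
    mean (fun x => `|h x| ^+ 2) <= \sum_i `|fourier_coef h (kap i)| ^+ 2 + e%:C.
Proof.
move=> bh e0; have [p [/trigpoly_trig[m [kap [c [kinj ->]]]] hp]] := cbounded_trig_approx bh e0.
exists m, kap; split => //.
rewrite mean_sqr_dist// in hp.
rewrite -lerBlDl; apply: le_trans hp; rewrite lerDl.
by apply: sumr_ge0 => i _; exact: exprn_ge0.
Qed.

End Completeness.

(** * Truncation error on the first characters *)

Section Shift.
Variable R : realType.
Implicit Types (h g : R -> R[i]) (k : int).

Lemma fourier_coef_shift h k l :
  fourier_coef (fun x => h x * fexp l x) k = fourier_coef h (k - l).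
Proof.
rewrite !fourier_coefE; congr mean; apply/funext => x.
by rewrite -!fexpN opprB fexpD mulrA.
Qed.

Lemma fourier_coefJ h k : cbounded h ->
  fourier_coef (fun x => (h x)^*) k = (fourier_coef h (- k))^*.
Proof.
move=> bh; rewrite !fourier_coefE -meanJ; last first.
  by apply: cboundedM => //; apply: cboundedJ; exact: cbounded_fexp.
by congr mean; apply/funext => x; rewrite rmorphM/= fexpN !conjCK.
Qed.

Lemma norm_fexp k (x : R) : `|fexp k x| = 1.
Proof.
apply/eqP; rewrite -(@pexpr_eq1 _ _ 2)// normCK mulrC; apply/eqP.
by rewrite -fexpN -fexpD addNr fexp0.
Qed.

Lemma mean_sqr_trig (I : finType) (kap : I -> int) (c : I -> R[i]) :
  injective kap -> mean (fun x => `|trig kap c x| ^+ 2) = \sum_i `|c i| ^+ 2.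
Proof.
move=> kinj; under eq_fun do rewrite normCK.
rewrite mean_mul_trigJ; last exact: cbounded_trig.
by apply: eq_bigr => i _; rewrite fourier_coef_trig// normCK mulrC.
Qed.

(** The indices [b] for which row [k + b] leaves the [n * n] block lie within
    [|k|] of one end of the range: the upper end if [0 <= k], the lower end
    otherwise.  The auxiliary function [j] is the distance to that end. *)
Lemma card_miss n k :
  (#|[pred b : 'I_n | ~~ ((0 <= k + b%:Z)%R && (k + b%:Z < n%:Z)%R)]| <= absz k)%N.
Proof.
set P := [pred b : 'I_n | _].
pose j (b : 'I_n) : nat := if 0 <= k then (n.-1 - b)%N else b.
have jinj : injective j.
  move=> b b' /eqP; rewrite /j; case: ifP => _ /eqP h; apply: val_inj => //=.
  by have := ltn_ord b; have := ltn_ord b'; lia.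
rewrite -(size_iota 0 (absz k)) cardE -(size_map j).
apply: uniq_leq_size; first by rewrite map_inj_uniq// enum_uniq.
move=> _ /mapP[b + ->]; rewrite mem_enum inE mem_iota /j => /negP bP.
have bn := ltn_ord b; case: ifPn => k0; lia.
Qed.

(** For each [b], the inner difference is at most the sum over the frequencies
    [k] with [k + b] outside [[0, n)]; exchanging the two sums, card_miss
    counts the [b] that miss a given [k]. *)
Lemma sum_diagonals (F : numDomainType) n m (x : int -> F) (kap : 'I_m -> int) :
  (forall k, 0 <= x k) -> injective kap ->
  \sum_(b < n) (\sum_i x (kap i) - \sum_(a < n) x (a%:Z - b%:Z)) <=
  \sum_i (absz (kap i))%:R * x (kap i).
Proof.
move=> x0 kinj.
pose P (b : 'I_n) i := (0 <= kap i + b%:Z) && (kap i + b%:Z < n%:Z).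
apply: (@le_trans _ _ (\sum_(b < n) \sum_(i | ~~ P b i) x (kap i))).
  apply: ler_sum => b _; rewrite lerBlDr (bigID (P b))/= addrC lerD2l.
  (* [h i] is the column where frequency [kap i] meets row [b]; the default
     value [b] only occurs when there is none. *)
  pose h i : 'I_n := insubd b (absz (kap i + b%:Z)).
  have hE i : P b i -> (h i)%:Z = kap i + b%:Z.
    move=> /andP[k0 kn]; rewrite /h val_insubd ifT; lia.
  rewrite (partition_big h xpredT)//=; apply: ler_sum => a _.
  have [i0 /andP[Pi0 /eqP hi0]|none] := pickP [pred i | P b i && (h i == a)].
    rewrite (bigD1 i0)/=; last by rewrite Pi0 hi0 eqxx.
    rewrite big1 ?addr0.
      by have := hE _ Pi0; rewrite hi0 => ->; rewrite addrK.
    move=> i /andP[/andP[Pi /eqP hi] ii0]; case/eqP: ii0; apply: kinj.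
    by apply: (addIr b%:Z); rewrite -!hE// hi hi0.
  by rewrite big_pred0.
rewrite (exchange_big_dep xpredT)//=; apply: ler_sum => i _.
rewrite sumr_const -[leLHS]mulr_natl; apply: ler_wpM2r => //; rewrite ler_nat.
exact: card_miss.
Qed.

(** Finite families of frequencies stand for the infinite sum of [|k| |h_k|^2],
    so that every sum of coefficients is a finite sum of complex numbers. *)
Definition energy_le h (S : R) := forall m (kap : 'I_m -> int), injective kap ->
  \sum_i (absz (kap i))%:R * `|fourier_coef h (kap i)| ^+ 2 <= S%:C.

Lemma energy_leJ h S : cbounded h -> energy_le h S -> energy_le (fun x => (h x)^*) S.
Proof.
move=> bh hS m kap kinj.
apply: le_trans (hS m (fun i => - kap i) _); last by move=> i j /oppr_inj/kinj.
rewrite le_eqVlt; apply/orP; left; apply/eqP/eq_bigr => i _.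
by rewrite abszN fourier_coefJ// norm_conjC.
Qed.

(** The squared distances from the [h e_b], [b < n], to the span of
    [e_0, .., e_{n-1}] are the means of [|h|^2] minus the squared coefficients
    [h_{a-b}] with [a < n]; Parseval's inequality turns this into the sum of
    the other squared coefficients, which sum_diagonals bounds. *)
Lemma sum_truncation_error n h S : cbounded h -> energy_le h S ->
  \sum_(b < n) mean (fun x => `|h x * fexp b x -
      \sum_(a < n) fourier_coef h (a%:Z - b%:Z) * fexp a x| ^+ 2) <= S%:C.
Proof.
move=> bh hS.
have E (b : 'I_n) : mean (fun x => `|h x * fexp b x -
      \sum_(a < n) fourier_coef h (a%:Z - b%:Z) * fexp a x| ^+ 2) =
    mean (fun x => `|h x| ^+ 2) - \sum_(a < n) `|fourier_coef h (a%:Z - b%:Z)| ^+ 2.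
  have bhb : cbounded (fun x => h x * fexp b x).
    by apply: cboundedM => //; exact: cbounded_fexp.
  rewrite (@mean_sqr_dist _ _ (fun a : 'I_n => a%:Z)
    (fun a : 'I_n => fourier_coef h (a%:Z - b%:Z)))//; last first.
    by move=> i j [] /val_inj.
  rewrite [X in _ + X]big1 ?addr0; last first.
    by move=> a _; rewrite fourier_coef_shift subrr normr0 expr0n.
  congr (mean _ - _); last by apply: eq_bigr => a _; rewrite fourier_coef_shift.
  by apply/funext => x; rewrite normrM norm_fexp mulr1.
rewrite (eq_bigr _ (fun b _ => E b)).
apply/ler_addgt0Pr => e e0.
have [r re] : exists r : R, e = r%:C by exists (complex.Re e); rewrite RRe_real// gtr0_real.
have r0 : 0 < r by rewrite re ltcR in e0.
have rn : 0 < r / n.+1%:R by rewrite divr_gt0.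
have [m [kap [kinj hm]]] := mean_sqr_le_coefs bh rn.
apply: le_trans (_ : \sum_(b < n) (\sum_i `|fourier_coef h (kap i)| ^+ 2
    - \sum_(a < n) `|fourier_coef h (a%:Z - b%:Z)| ^+ 2) + \sum_(b < n) (r / n.+1%:R)%:C <= _).
  rewrite -big_split/=; apply: ler_sum => b _.
  by rewrite addrAC lerD2r.
apply: lerD.
  apply: le_trans (hS _ _ kinj).
  exact: (@sum_diagonals _ n m (fun k => `|fourier_coef h k| ^+ 2)).
rewrite sumr_const card_ord -rmorphMn/= re lecR -mulr_natl mulrCA ger_pMr//.
by rewrite ler_pdivrMr// mul1r ler_nat.
Qed.

End Shift.

(** * Traces of functions of the Gram matrix of a Toeplitz matrix *)

Section Rows.
Variable C : numClosedFieldType.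
Implicit Types (m n : nat).

Definition sqnorm n (v : 'rV[C]_n) : C := \sum_j `|v 0 j| ^+ 2.

Lemma sqnormE n (v : 'rV[C]_n) : sqnorm v = (v *m v^h) 0 0.
Proof. by rewrite mxE; apply: eq_bigr => j _; rewrite !mxE normCK. Qed.

Lemma sqnorm_ge0 n (v : 'rV[C]_n) : 0 <= sqnorm v.
Proof. by apply: sumr_ge0 => j _; exact: exprn_ge0. Qed.

Lemma hermM m n p (A : 'M[C]_(m, n)) (B : 'M[C]_(n, p)) : (A *m B)^h = B^h *m A^h.
Proof. by rewrite trmx_mul map_mxM. Qed.

Lemma hermK m n (A : 'M[C]_(m, n)) : A^h^h = A.
Proof. by apply/matrixP => i j; rewrite !mxE conjCK. Qed.

Lemma sqnorm_unitary n (v : 'rV[C]_n) (U : 'M[C]_n) :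
  U *m U^h = 1%:M -> sqnorm (v *m U) = sqnorm v.
Proof. by move=> UU; rewrite !sqnormE hermM -mulmxA (mulmxA U) UU mul1mx. Qed.

Lemma sqnormD_le n (v w : 'rV[C]_n) : sqnorm (v + w) <= 2 * sqnorm v + 2 * sqnorm w.
Proof.
rewrite !mulr_sumr -big_split/=; apply: ler_sum => j _; rewrite mxE.
exact: normD_sqr_le.
Qed.

Lemma sqnormZ n (a : C) (v : 'rV[C]_n) : sqnorm (a *: v) = `|a| ^+ 2 * sqnorm v.
Proof.
by rewrite mulr_sumr; apply: eq_bigr => j _; rewrite mxE normrM exprMn.
Qed.

End Rows.

Section Toeplitz_matrix.
Variables (R : realType) (n : nat) (f : R -> R[i]) (F S : R).
Hypotheses (bf : cbounded f) (fF : forall x, `|f x| <= F%:C) (fS : energy_le f S).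
Let A := toeplitz n f.
Implicit Types (x : R).

Let FC2 : (F ^+ 2)%:C = F%:C ^+ 2.
Proof. by rewrite rmorphXn. Qed.

Let f2F x : `|f x| ^+ 2 <= (F ^+ 2)%:C.
Proof. by rewrite FC2 lerXn2r ?nnegrE// (le_trans _ (fF x)). Qed.

Let F2_ge0 : 0 <= (F ^+ 2)%:C.
Proof. exact: le_trans (f2F 0). Qed.

Lemma mean_sqr_mul_le h : cbounded h ->
  mean (fun x => `|f x * h x| ^+ 2) <= (F ^+ 2)%:C * mean (fun x => `|h x| ^+ 2).
Proof.
move=> bh; rewrite -meanZ; last exact: cbounded_sqr_norm.
apply: le_mean => [||x].
- by apply: cbounded_sqr_norm; exact: cboundedM.
- by apply: cboundedM; [exact: cbounded_cst|exact: cbounded_sqr_norm].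
- by rewrite normrM exprMn ler_wpM2r// exprn_ge0.
Qed.

(** [||v A|| <= F ||v||]: the entries of [v A] are Fourier coefficients of
    [f] times a trigonometric polynomial with coefficients [v]. *)
Lemma sqnorm_toeplitz_row (v : 'rV_n) : sqnorm (v *m A) <= (F ^+ 2)%:C * sqnorm v.
Proof.
pose k (a : 'I_n) : int := - a%:Z.
have kinj : injective k by move=> a b /oppr_inj[] /val_inj.
pose X := trig k (fun a => v 0 a).
have bX : cbounded X by exact: cbounded_trig.
have -> : sqnorm v = mean (fun x => `|X x| ^+ 2) by rewrite mean_sqr_trig.
apply: le_trans (mean_sqr_mul_le bX); apply: le_trans (bessel kinj _); last exact: cboundedM.
rewrite le_eqVlt; apply/orP; left; apply/eqP/eq_bigr => b _; congr (`|_| ^+ 2).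
rewrite mxE fourier_coefE (_ : (fun x => _) = fun x =>
    \sum_a v 0 a * (f x * (fexp (a%:Z - b%:Z) x)^*)).
  rewrite mean_sum => [|a].
    apply: eq_bigr => a _; rewrite meanZ -?fourier_coefE ?mxE//.
    by apply: cboundedM => //; apply: cboundedJ; exact: cbounded_fexp.
  apply: cboundedM; first exact: cbounded_cst.
  by apply: cboundedM => //; apply: cboundedJ; exact: cbounded_fexp.
apply/funext => x; rewrite /X /trig mulr_sumr mulr_suml; apply: eq_bigr => a _.
rewrite -!fexpN /k opprB opprK mulrCA -!mulrA; congr (_ * (_ * _)).
by rewrite -fexpD addrC.
Qed.

Definition exprow x : 'rV[R[i]]_n := \row_(a < n) fexp a x.

Lemma sqnorm_exprow x : sqnorm (exprow x) = n%:R.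
Proof.
rewrite /sqnorm (eq_bigr (fun=> 1)) => [|a _]; last by rewrite mxE norm_fexp expr1n.
by rewrite sumr_const card_ord.
Qed.

(** Residues of multiplication by [f], resp. by its conjugate, on the span of
    the first [n] characters. *)
Let w x := f x *: exprow x - exprow x *m A.
Let w' x := (f x)^* *: exprow x - exprow x *m A^h.

Let bexp a : cbounded (fun x => exprow x 0 a).
Proof. by under eq_fun do rewrite mxE; exact: cbounded_fexp. Qed.

Lemma cbounded_exprow_mul (B : 'M[R[i]]_n) b : cbounded (fun x => (exprow x *m B) 0 b).
Proof.
rewrite (_ : (fun x => _) = fun x => \sum_a exprow x 0 a * B a b).
  by apply: cbounded_sum => a; apply: cboundedM => //; exact: cbounded_cst.
by apply/funext => x; rewrite mxE.
Qed.

Lemma cbounded_residue (h : R -> R[i]) (B : 'M[R[i]]_n) b : cbounded h ->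
  cbounded (fun x => (h x *: exprow x - exprow x *m B) 0 b).
Proof.
move=> bh; rewrite (_ : (fun x => _) = fun x => h x * exprow x 0 b - (exprow x *m B) 0 b).
  by apply: cboundedB; [exact: cboundedM|exact: cbounded_exprow_mul].
by apply/funext => x; rewrite [LHS]mxE [X in X + _]mxE [X in _ + X]mxE.
Qed.

Lemma mean_sqnorm_residue h (B : 'M[R[i]]_n) : cbounded h -> energy_le h S ->
  (forall a b, B a b = fourier_coef h (a%:Z - b%:Z)) ->
  mean (fun x => sqnorm (h x *: exprow x - exprow x *m B)) <= S%:C.
Proof.
move=> bh hS BE.
rewrite [leLHS]mean_sum => [|b]; last by apply: cbounded_sqr_norm; exact: cbounded_residue.
rewrite (le_trans _ (@sum_truncation_error _ n _ _ bh hS))// le_eqVlt; apply/orP; left.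
apply/eqP/eq_bigr => b _; congr mean; apply/funext => x; congr (`|_| ^+ 2).
rewrite [LHS]mxE [X in X + _]mxE [X in _ + X]mxE mxE; congr (_ * _ - _).
by rewrite mxE; apply: eq_bigr => a _; rewrite BE mxE mulrC.
Qed.

Lemma mean_sqnorm_w : mean (fun x => sqnorm (w x)) <= S%:C.
Proof. by apply: mean_sqnorm_residue => // a b; rewrite mxE. Qed.

Lemma mean_sqnorm_w' : mean (fun x => sqnorm (w' x)) <= S%:C.
Proof.
apply: mean_sqnorm_residue.
- exact: cboundedJ.
- exact: energy_leJ.
- by move=> a b; rewrite !mxE fourier_coefJ// opprB.
Qed.

Section Diagonalization.
Variables (U : 'M[R[i]]_n) (d : 'rV[R[i]]_n).
Hypotheses (UU : U *m U^h = 1%:M) (AU : A^h *m A *m U = U *m diag_mx d).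

Let u j x := (exprow x *m U) 0 j.
Let s j := complex.Re (d 0 j).

Let UhU : U^h *m U = 1%:M.
Proof. exact: mulmx1C. Qed.

(** Compressing [f] first and then its conjugate differs from compressing
    [|f|^2] by one residue of each. *)
Lemma residue_split x : exprow x *m (`|f x| ^+ 2 *: 1%:M - A^h *m A) =
  (f x)^* *: w x + w' x *m A.
Proof.
rewrite mulmxBr -scalemxAr mulmx1 /w /w' scalerBr mulmxBl -!scalemxAl scalerA.
by rewrite -mulmxA normCK [(f x)^* * f x]mulrC addrA subrK mulmxA.
Qed.

Lemma sum_sqr_residue x :
  \sum_j `|u j x| ^+ 2 * `| `|f x| ^+ 2 - d 0 j| ^+ 2 <=
  2 * (F ^+ 2)%:C * (sqnorm (w x) + sqnorm (w' x)).
Proof.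
have -> : \sum_j `|u j x| ^+ 2 * `| `|f x| ^+ 2 - d 0 j| ^+ 2 =
    sqnorm (exprow x *m (`|f x| ^+ 2 *: 1%:M - A^h *m A) *m U).
  apply: eq_bigr => j _; rewrite -exprMn -normrM; congr (`|_| ^+ 2).
  rewrite -[exprow x *m _ *m U]mulmxA mulmxBl AU -scalemxAl mul1mx mulmxBr -scalemxAr mulmxA.
  rewrite mul_mx_diag [RHS]mxE [X in _ = X + _]mxE [X in _ = _ + X]mxE.
  by rewrite [X in _ = _ - X]mxE /u; ring.
rewrite [leLHS](sqnorm_unitary _ UU) residue_split mulrDr.
apply: le_trans (sqnormD_le ((f x)^* *: w x) (w' x *m A)) _.
apply: lerD; rewrite -[leRHS]mulrA ler_pM2l ?ltr0n//; last exact: sqnorm_toeplitz_row.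
rewrite sqnormZ norm_conjC; apply: ler_wpM2r => //; exact: sqnorm_ge0.
Qed.

Let bu j : cbounded (u j).
Proof. exact: cbounded_exprow_mul. Qed.

Let uE j : u j = trig (fun a : 'I_n => a%:Z) (fun a => U a j).
Proof.
by apply/funext => x; rewrite /u mxE; apply: eq_bigr => a _; rewrite mxE mulrC.
Qed.

Let natI : injective (fun a : 'I_n => a%:Z).
Proof. by move=> a b [] /val_inj. Qed.

Lemma sum_sqr_u x : \sum_j `|u j x| ^+ 2 = n%:R.
Proof. by rewrite -[LHS]/(sqnorm _) [LHS](sqnorm_unitary _ UU) sqnorm_exprow. Qed.

Lemma mean_sqr_u j : mean (fun x => `|u j x| ^+ 2) = 1.
Proof.
rewrite uE mean_sqr_trig//.
have /matrixP/(_ j j) := UhU; rewrite !mxE eqxx mulr1n => <-.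
by apply: eq_bigr => a _; rewrite !mxE normCK mulrC.
Qed.

Lemma fourier_coef_fu j (a : 'I_n) :
  fourier_coef (fun x => f x * u j x) a%:Z = (A *m U) a j.
Proof.
rewrite mxE fourier_coefE.
rewrite (_ : (fun x => _) = fun x => \sum_b U b j * (f x * (fexp (a%:Z - b%:Z) x)^*)).
  have b1 b : cbounded (fun x => f x * (fexp (a%:Z - b) x)^*).
    by apply: cboundedM => //; apply: cboundedJ; exact: cbounded_fexp.
  rewrite mean_sum => [|b]; last by apply: cboundedM => //; exact: cbounded_cst.
  by apply: eq_bigr => b _; rewrite meanZ// -fourier_coefE mxE mulrC.
apply/funext => x; rewrite uE /trig mulr_sumr mulr_suml; apply: eq_bigr => b _.
by rewrite -!fexpN opprB addrC fexpD; ring.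
Qed.

(** The diagonal of [U^h A^h A U]. *)
Lemma sum_sqr_AU j : \sum_a `|(A *m U) a j| ^+ 2 = d 0 j.
Proof.
have : U^h *m (A^h *m A *m U) = diag_mx d by rewrite AU mulmxA UhU mul1mx.
rewrite -!mulmxA mulmxA -hermM => /matrixP/(_ j j); rewrite [RHS]mxE eqxx mulr1n => <-.
by rewrite mxE; apply: eq_bigr => a _; rewrite [X in X * _]mxE [X in X^* * _]mxE normCK mulrC.
Qed.

Lemma eigenvalue_ge0 j : 0 <= d 0 j.
Proof. by rewrite -sum_sqr_AU; apply: sumr_ge0 => a _; exact: exprn_ge0. Qed.

Let dE j : d 0 j = (s j)%:C.
Proof. by rewrite /s RRe_real// ger0_real// eigenvalue_ge0. Qed.

(** The upper bound is Bessel's inequality for [f U_j]. *)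
Lemma eigenvalue_bounds j : 0 <= s j <= F ^+ 2.
Proof.
rewrite -ler0c -lecR -dE eigenvalue_ge0/= -sum_sqr_AU.
have bfu : cbounded (fun x => f x * u j x) by exact: cboundedM.
rewrite -[leRHS]mulr1 -(mean_sqr_u j); apply: le_trans (mean_sqr_mul_le (bu j)).
apply: le_trans (bessel natI bfu).
by rewrite le_eqVlt; apply/orP; left; apply/eqP/eq_bigr => a _; rewrite fourier_coef_fu.
Qed.

Let wu j x := (w x *m U) 0 j.

Let wuE j x : wu j x = f x * u j x - trig (fun a : 'I_n => a%:Z) (fun a => (A *m U) a j) x.
Proof.
rewrite /wu /w mulmxBl -scalemxAl -mulmxA [LHS]mxE [X in X + _]mxE [X in _ + X]mxE.
congr (_ - _); rewrite mxE; apply: eq_bigr => a _; by rewrite [X in X * _]mxE mulrC.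
Qed.

Let bwu j : cbounded (wu j).
Proof.
rewrite (_ : wu j = fun x => f x * u j x -
    trig (fun a : 'I_n => a%:Z) (fun a => (A *m U) a j) x); last first.
  by apply/funext => x; exact: wuE.
by apply: cboundedB; [exact: cboundedM|exact: cbounded_trig].
Qed.

Let bf2 : cbounded (fun x => `|f x| ^+ 2). Proof. exact: cbounded_sqr_norm. Qed.
Let bu2 j : cbounded (fun x => `|u j x| ^+ 2). Proof. exact: cbounded_sqr_norm. Qed.

(** [f U_j] has squared norm the mean of [|U_j|^2 |f|^2], and its projection to
    the first characters has coefficient vector [A u_j], of squared norm
    [d 0 j]. *)
Lemma mean_linear_term j :
  mean (fun x => `|u j x| ^+ 2 * (`|f x| ^+ 2 - d 0 j)) = mean (fun x => `|wu j x| ^+ 2).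
Proof.
have bfu : cbounded (fun x => f x * u j x) by exact: cboundedM.
under [in RHS]eq_fun do rewrite wuE.
rewrite mean_sqr_dist// [X in _ + X]big1 => [|a _]; last first.
  by rewrite fourier_coef_fu subrr normr0 expr0n.
rewrite addr0 (eq_bigr _ (fun a _ => congr1 (fun z => `|z| ^+ 2) (fourier_coef_fu j a))) sum_sqr_AU.
rewrite (_ : (fun x => _ * _) = fun x => `|f x * u j x| ^+ 2 - d 0 j * `|u j x| ^+ 2).
  rewrite meanB ?meanZ ?mean_sqr_u ?mulr1//; first exact: cbounded_sqr_norm.
  by apply: cboundedM => //; exact: cbounded_cst.
by apply/funext => x; rewrite normrM exprMn; ring.
Qed.

Lemma sum_mean_wu : \sum_j mean (fun x => `|wu j x| ^+ 2) <= S%:C.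
Proof.
rewrite -mean_sum => [|j]; last exact: cbounded_sqr_norm.
rewrite (_ : (fun x => _) = fun x => sqnorm (w x)); first exact: mean_sqnorm_w.
by apply/funext => x; rewrite -[RHS](sqnorm_unitary _ UU).
Qed.

Let q j x := `|u j x| ^+ 2 * `| `|f x| ^+ 2 - d 0 j| ^+ 2.

Let bq j : cbounded (q j).
Proof.
by apply: cboundedM => //; apply: cbounded_sqr_norm; apply: cboundedB => //; exact: cbounded_cst.
Qed.

Lemma sum_mean_q : \sum_j mean (q j) <= (4 * F ^+ 2 * S)%:C.
Proof.
rewrite -mean_sum//.
have bw : cbounded (fun x => sqnorm (w x)).
  by apply: cbounded_sum => b; apply: cbounded_sqr_norm; exact: cbounded_residue.
have bw' : cbounded (fun x => sqnorm (w' x)).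
  by apply: cbounded_sum => b; apply: cbounded_sqr_norm; apply: cbounded_residue; exact: cboundedJ.
have c2 := cbounded_cst (2 * (F ^+ 2)%:C).
apply: le_trans (_ : mean (fun x => 2 * (F ^+ 2)%:C * (sqnorm (w x) + sqnorm (w' x))) <= _).
  apply: le_mean => [||x]; last exact: sum_sqr_residue.
    exact: cbounded_sum.
  by apply: cboundedM => //; exact: cboundedD.
rewrite meanZ; last exact: cboundedD.
rewrite meanD// (_ : (4 * F ^+ 2 * S)%:C = 2 * (F ^+ 2)%:C * (S%:C + S%:C)).
  apply: ler_wpM2l; first by rewrite mulr_ge0.
  by apply: lerD; [exact: mean_sqnorm_w|exact: mean_sqnorm_w'].
by rewrite !rmorphM/= (rmorph_nat (real_complex R) 4); ring.
Qed.

(** One-sided, so that the two-sided bound follows from [g] and [- g].  At each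
    point, the one-sided Taylor estimate is weighted by [|u j|^2], whose sum
    over [j] is [n] and whose means are [1]. *)
Lemma trace_upper (g g1 : R -> R) (K1 K2 : R) :
  (forall t, 0 <= t <= F ^+ 2 -> `|g1 t| <= K1) -> 0 <= K2 ->
  (forall t r, 0 <= t <= F ^+ 2 -> 0 <= r <= F ^+ 2 ->
    g t - g r <= - g1 t * (r - t) + K2 / 2 * (r - t) ^+ 2) ->
  cbounded (fun x => (g (Normc.normc (f x) ^+ 2))%:C) ->
  \sum_j (g (s j))%:C - n%:R * mean (fun x => (g (Normc.normc (f x) ^+ 2))%:C) <=
  (S * (K1 + 2 * F ^+ 2 * K2))%:C.
Proof.
move=> hK1 K20 hg bg.
set r := fun x => Normc.normc (f x) ^+ 2 in bg *.
have fr x : `|f x| ^+ 2 = (r x)%:C by rewrite rmorphXn.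
have rI x : 0 <= r x <= F ^+ 2 by rewrite sqr_ge0 -lecR -fr f2F.
have -> : \sum_j (g (s j))%:C - n%:R * mean (fun x => (g (r x))%:C) =
    \sum_j mean (fun x => `|u j x| ^+ 2 * (g (s j) - g (r x))%:C).
  have E j : mean (fun x => `|u j x| ^+ 2 * (g (s j) - g (r x))%:C) =
      (g (s j))%:C - mean (fun x => `|u j x| ^+ 2 * (g (r x))%:C).
    rewrite (_ : (fun x => _) = fun x =>
        (g (s j))%:C * `|u j x| ^+ 2 - `|u j x| ^+ 2 * (g (r x))%:C).
      rewrite meanB ?meanZ ?mean_sqr_u ?mulr1//.
        by apply: cboundedM => //; exact: cbounded_cst.
      exact: cboundedM.
    by apply/funext => x; rewrite rmorphB/= mulrBr mulrC.
  rewrite (eq_bigr _ (fun j _ => E j)) big_split/= sumrN; congr (_ - _).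
  rewrite -mean_sum => [|j]; last exact: cboundedM.
  rewrite -meanZ//; congr mean; apply/funext => x.
  by rewrite -mulr_suml sum_sqr_u.
apply: le_trans (_ : \sum_j (K1%:C * mean (fun x => `|wu j x| ^+ 2)
    + (K2 / 2)%:C * mean (q j)) <= _).
  apply: ler_sum => j _.
  apply: le_trans (_ : mean (fun x => - (g1 (s j))%:C * (`|u j x| ^+ 2 * (`|f x| ^+ 2 - d 0 j))
      + (K2 / 2)%:C * q j x) <= _).
    apply: le_mean => [||x].
    - apply: cboundedM => //.
      rewrite (_ : (fun x => _) = fun x => (g (s j))%:C - (g (r x))%:C).
        by apply: cboundedB => //; exact: cbounded_cst.
      by apply/funext => x; rewrite rmorphB.
    - apply: cboundedD; apply: cboundedM => //; try exact: cbounded_cst.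
      by apply: cboundedM => //; apply: cboundedB => //; exact: cbounded_cst.
    - rewrite /q fr dE -!rmorphB/= [X in _ <= X + _]mulrCA [X in _ <= _ + X]mulrCA -mulrDr.
      apply: ler_wpM2l; first exact: exprn_ge0.
      rewrite (_ : `|_| ^+ 2 = ((r x - s j) ^+ 2)%:C); last first.
        by rewrite -add_Re2_Im2/= expr0n/= addr0.
      rewrite -!rmorphN -!rmorphM -rmorphD/= lecR; apply: hg => //; exact: eigenvalue_bounds.
  have b1 : cbounded (fun x => `|u j x| ^+ 2 * (`|f x| ^+ 2 - d 0 j)).
    by apply: cboundedM => //; apply: cboundedB => //; exact: cbounded_cst.
  rewrite meanD ?meanZ//; last 2 first.
  - by apply: cboundedM => //; exact: cbounded_cst.
  - by apply: cboundedM => //; exact: cbounded_cst.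
  rewrite mean_linear_term lerD2r; apply: ler_wpM2r.
    rewrite -(mean_cst 0); apply: le_mean => [||x]; [exact: cbounded_cst| |exact: exprn_ge0].
    exact: cbounded_sqr_norm.
  rewrite -rmorphN lecR; apply: le_trans (hK1 _ (eigenvalue_bounds j)).
  by rewrite -normrN ler_norm.
rewrite big_split/= -mulr_sumr -[X in _ + X <= _]mulr_sumr.
have K10 : 0 <= K1 by apply: le_trans (hK1 0 _); rewrite ?lexx//= sqr_ge0.
apply: le_trans (_ : K1%:C * S%:C + (K2 / 2)%:C * (4 * F ^+ 2 * S)%:C <= _).
  apply: lerD; apply: ler_wpM2l; rewrite ?ler0c ?divr_ge0//.
    exact: sum_mean_wu.
  exact: sum_mean_q.
rewrite -!rmorphM -rmorphD/= lecR le_eqVlt; apply/orP; left; apply/eqP; by field.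
Qed.

End Diagonalization.
End Toeplitz_matrix.

(** * Taylor's formula and a Sobolev-type bound *)

Section Calculus.
Variable R : realType.
Local Notation mu := (@lebesgue_measure R).

Lemma is_derive_continuous (F F' : R -> R) :
  (forall x : R, is_derive x (1 : R) F (F' x)) -> continuous F.
Proof.
move=> dF x; apply/differentiable_continuous/derivable1_diffP.
by have [] := dF x.
Qed.

(** The sign condition locates [c] without ordering the endpoints, as needed
    for Taylor's formula on either side of the base point. *)
Lemma mean_value (F F' : R -> R) (L a b : R) :
  (forall x : R, is_derive x (1 : R) F (F' x)) ->
  0 <= a <= L -> 0 <= b <= L ->
  exists c, [/\ 0 <= c <= L, 0 <= (c - a) * (b - a) & F b - F a = F' c * (b - a)].
Proof.
move=> dF aL bL; have cF := is_derive_continuous dF.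
have [ab|/ltW ba] := leP a b.
  have [c cI Fc] := MVT_segment ab (fun x _ => dF x) (continuous_subspaceT cF).
  move: cI; rewrite in_itv/= => /andP[ac cb].
  by exists c; split => //; [lra|rewrite mulr_ge0// subr_ge0].
have [c cI Fc] := MVT_segment ba (fun x _ => dF x) (continuous_subspaceT cF).
move: cI; rewrite in_itv/= => /andP[bc ca].
exists c; split; [lra|nra|].
by rewrite -opprB Fc -mulrN opprB.
Qed.

(** The difference [phi] of the two sides, as a function of [r], vanishes at
    [t]; by the mean value theorem for [g1], its derivative at [c] is
    [(g2 e + K) (c - t)] for some [e], which has the sign of [c - t]. *)
Lemma taylor_upper (g g1 g2 : R -> R) (L K t r : R) :
  (forall x : R, is_derive x (1 : R) g (g1 x)) ->
  (forall x : R, is_derive x (1 : R) g1 (g2 x)) ->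
  (forall x, 0 <= x <= L -> `|g2 x| <= K) ->
  0 <= t <= L -> 0 <= r <= L ->
  g t - g r <= - g1 t * (r - t) + K / 2 * (r - t) ^+ 2.
Proof.
move=> dg dg1 hK tL rL.
pose phi x := g x - (g1 t * x - (K / 2) * (x - t) ^+ 2).
pose phi1 x := g1 x - (g1 t - K * (x - t)).
have dphi (x : R) : is_derive x (1 : R) phi (phi1 x).
  by rewrite /phi; apply: is_derive_eq; rewrite /phi1 /GRing.scale/=; field.
have [c [cL ctr phic]] := mean_value dphi tL rL.
have [e [eL ect g1c]] := mean_value dg1 tL cL.
have : 0 <= phi r - phi t.
  rewrite phic; have -> : phi1 c = (g2 e + K) * (c - t) by rewrite /phi1 mulrDl -g1c; ring.
  rewrite -mulrA mulr_ge0//.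
  by have := hK _ eL; rewrite ler_norml => /andP[]; lra.
by rewrite /phi subrr expr0n/= mulr0; lra.
Qed.

(** On an interval of length one starting at [x0], the minimum of [|h|] is at
    most its integral, the oscillation of [h] is at most the integral of
    [|h1|], and the Cauchy-Schwarz inequality bounds the latter by the
    [L^2]-norm.  The majorants [a] and [a1] allow [h] to be the real or the
    imaginary part of a complex function whose modulus is integrated. *)
Lemma sup_le_norms (h h1 a a1 : R -> R) (x0 : R) :
  (forall x : R, is_derive x (1 : R) h (h1 x)) -> continuous h1 ->
  measurable_fun setT a -> measurable_fun setT a1 ->
  (forall x, `|h x| <= a x) -> (forall x, `|h1 x| <= a1 x) ->
  (`|h x0|%:E <= Lnorm mu 1 (EFin \o a) + Lnorm mu 2%:E (EFin \o a1))%E.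
Proof.
move=> dh ch1 ma ma1 ha ha1.
have ch := is_derive_continuous dh.
have mh : measurable_fun setT h by exact: continuous_measurable_fun.
have mh1 : measurable_fun setT h1 by exact: continuous_measurable_fun.
have a0 x : 0 <= a x by exact: le_trans (ha x).
have a10 x : 0 <= a1 x by exact: le_trans (ha1 x).
set I := `[x0, x0 + 1]%classic : set R.
have mI : measurable I by exact: measurable_itv.
have muI : mu I = 1%E.
  by rewrite /I lebesgue_measure_itv/= lte_fin ltrDl ltr01 -EFinB addrAC subrr add0r.
have x1 : x0 <= x0 + 1 by rewrite lerDl.
have cnh : continuous (fun x => `|h x|).
  by move=> x; apply: cvg_norm; exact: ch.
have [y yI hy] := EVT_min x1 (continuous_subspaceT cnh).
have step_a : (`|h y|%:E <= Lnorm mu 1 (EFin \o a))%E.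
  rewrite Lnorm1; apply: le_trans (_ : (\int[mu]_(x in I) (a x)%:E <= _)%E); last first.
    under [leRHS]eq_integral do rewrite /= ger0_norm//.
    by apply: ge0_subset_integral => //; [exact/measurable_EFinP|move=> x _; rewrite lee_fin].
  rewrite -[leLHS]mule1 -muI -integral_cst//; apply: ge0_le_integral => //.
  - by move=> x _; rewrite lee_fin.
  - by apply/measurable_EFinP; exact: measurable_funTS.
  - by move=> x Ix; rewrite lee_fin (le_trans _ (ha x))// hy.
have step_c : (\int[mu]_(x in I) (a1 x)%:E <= Lnorm mu 2%:E (EFin \o a1))%E.
  have i0 : 0 < 2 :> R by [].
  have h22 : 2^-1 + 2^-1 = 1 :> R by field.
  have mi : measurable_fun setT (\1_I : R -> R) by exact: measurable_indic.
  have := hoelder mu ma1 mi i0 i0 h22.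
  rewrite Lnorm1 => H.
  have -> : Lnorm mu 2%:E (EFin \o a1) =
      (Lnorm mu 2%:E (EFin \o a1) * Lnorm mu 2%:E (EFin \o \1_I))%E.
    rewrite [X in (_ * X)%E](_ : _ = 1%E) ?mule1// Lnorm.unlock.
    rewrite (_ : \int[mu]_x _ = 1)%E ?poweR_EFin ?powR1//.
    rewrite -muI -[in RHS](setIT I) -integral_indic//.
    apply: eq_integral => x _; rewrite /= indicE.
    by case: (_ \in _) => /=; rewrite ?normr1 ?normr0 ?powR1 ?powR0.
  apply: le_trans H; rewrite [leLHS]integral_mkcond le_eqVlt; apply/orP; left; apply/eqP.
  apply: eq_integral => x _; rewrite /= patchE indicE.
  by case: ifP => _; rewrite ?mulr1 ?mulr0 ?normr0// ger0_norm.
have yI' : x0 <= y <= x0 + 1 by move: yI; rewrite in_itv.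
have step_b : (`|h y - h x0|%:E <= \int[mu]_(x in I) (a1 x)%:E)%E.
  have [x0y|] := ltP x0 y; last first.
    move=> yx0; have -> : y = x0 by apply/eqP; rewrite eq_le yx0; case/andP: yI' => ->.
    by rewrite subrr normr0; apply: integral_ge0 => x _; rewrite lee_fin.
  have dhy : derivable_oo_LRcontinuous h x0 y.
    split.
    + by move=> x _; have [] := dh x.
    + exact/cvg_at_right_filter/ch.
    + exact/cvg_at_left_filter/ch.
  have FTC : (\int[mu]_(x in `[x0, y]) (h1 x)%:E)%E = ((h y)%:E - (h x0)%:E)%E.
    apply: continuous_FTC2 => //; first exact: continuous_subspaceT.
    by move=> x _; rewrite derive1E; have [_] := dh x.
  rewrite -[leLHS]abse_EFin EFinB -FTC.
  have mJ : measurable (`[x0, y]%classic : set R) by exact: measurable_itv.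
  apply: le_trans (le_abse_integral _ _ _) _ => //.
    by apply/measurable_EFinP; exact: measurable_funTS.
  apply: le_trans (_ : \int[mu]_(x in `[x0, y]) (a1 x)%:E <= _)%E.
    apply: ge0_le_integral => //.
    - by apply/measurable_EFinP; apply: measurable_funTS; exact: measurableT_comp.
    - by apply/measurable_EFinP; exact: measurable_funTS.
    - by move=> x _; rewrite /= lee_fin.
  apply: ge0_subset_integral => //.
  - by apply/measurable_EFinP; exact: measurable_funTS.
  - by move=> x _; rewrite lee_fin.
  - move=> x; rewrite /I /= !in_itv/= => /andP[-> xy] /=.
    by case/andP: yI' => _; exact: le_trans.
apply: le_trans (_ : (`|h y|%:E + `|h y - h x0|%:E <= _)%E); last first.
  by apply: leeD => //; exact: le_trans step_c.
rewrite -EFinD lee_fin.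
have := ler_normB (h y) (h y - h x0).
by rewrite (_ : h y - (h y - h x0) = h x0)//; ring.
Qed.

End Calculus.

(** * A bounded representative of the symbol *)

Section Truncation.
Variable R : realType.
Local Notation mu := (@lebesgue_measure R).
Implicit Types (f k : R -> R[i]).

Lemma normc_ge0 (z : R[i]) : 0 <= Normc.normc z.
Proof. by case: z => a b; exact: sqrtr_ge0. Qed.

Lemma sqr_normc_ReIm (z : R[i]) :
  Normc.normc z ^+ 2 = complex.Re z ^+ 2 + complex.Im z ^+ 2.
Proof. by case: z => a b; rewrite sqr_sqrtr// addr_ge0// sqr_ge0. Qed.

Lemma cintegral_ae_eq k1 k2 : cmeasurable period k1 -> cmeasurable period k2 ->
  (\forall x \ae mu, period x -> k1 x = k2 x) ->
  cintegral period k1 = cintegral period k2.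
Proof.
move=> [m1 n1] [m2 n2] k12; have mp := @measurable_period R.
rewrite /cintegral; congr (_ +i* _); rewrite /Rintegral; congr fine;
  apply: ae_eq_integral => //; try exact/measurable_EFinP;
  by apply: negligibleS k12 => x /=; apply: contra_not => h /h ->.
Qed.

Lemma Linfty_norm_ae f : Linfty f ->
  exists2 F : R, 0 <= F & Linfty_norm f = F%:E /\
    \forall x \ae mu, period x -> Normc.normc (f x) <= F.
Proof.
move=> [_ fy]; have F0 : (0 <= Linfty_norm f)%E by exact: Lnorm_ge0.
have Ffin : Linfty_norm f \is a fin_num by rewrite ge0_fin_numE.
exists (fine (Linfty_norm f)); first exact: fine_ge0.
split; first by rewrite fineK.
have : (\forall x \ae mrestr mu (@measurable_period R),
    (`|(Normc.normc (f x))%:E| <= Linfty_norm f)%E).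
  rewrite /Linfty_norm Lnorm.unlock /= ifT; last first.
    by rewrite /mrestr setTI mu_period lte_fin mulr_gt0// pi_gt0.
  exact: ess_sup_inf.ess_sup_ge.
move=> [A [mA A0 sA]]; exists (A `&` period); split => //.
  by apply: measurableI => //; exact: measurable_period.
move=> x /= xF; split; last by apply: contrapT => xp; apply: xF.
apply: sA => /= xA; apply: xF => _.
rewrite -lee_fin fineK//; apply: le_trans xA; rewrite lee_fin ler_norm//.
Qed.

(** Vanishing outside the period and wherever [|f|] exceeds its essential
    supremum, which changes no integral over the period. *)
Definition truncate f (F : R) : R -> R[i] :=
  fun x => if `[< period x /\ Normc.normc (f x) <= F >] then f x else 0.

Lemma truncate_le f F x : 0 <= F -> Normc.normc (truncate f F x) <= F.
Proof.
move=> F0; rewrite /truncate; case: asboolP => [[]//|_].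
by rewrite Normc.normc0.
Qed.

Lemma cmeasurable_truncate f F : 0 <= F -> cmeasurable period f -> cbounded (truncate f F).
Proof.
move=> F0 [m1 m2]; have mp := @measurable_period R.
pose D := period `&` [set x | complex.Re (f x) ^+ 2 + complex.Im (f x) ^+ 2 <= F ^+ 2].
have mD : measurable D.
  have /(_ mp `]-oo, F ^+ 2]%classic (measurable_itv _)) : measurable_fun period
      (fun x => complex.Re (f x) ^+ 2 + complex.Im (f x) ^+ 2).
    by apply: measurable_funD; exact: measurable_funX.
  congr (measurable _); apply/seteqP; split=> x [px]/=; rewrite in_itv/=; by split.
have DE x : `[< period x /\ Normc.normc (f x) <= F >] = (x \in D).
  apply/asboolP/idP; rewrite inE /D /= -sqr_normc_ReIm => -[px h]; split => //.
    by rewrite ler_sqr// nnegrE// normc_ge0.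
  by rewrite -ler_sqr// nnegrE// normc_ge0.
have b x : `|complex.Re (truncate f F x)| <= F /\ `|complex.Im (truncate f F x)| <= F.
  have := truncate_le f x F0; rewrite -ler_sqr ?nnegrE ?normc_ge0//.
  rewrite sqr_normc_ReIm => h; rewrite -!(ler_sqr (normr_ge0 _))// !real_normK ?num_real//.
  have := sqr_ge0 (complex.Re (truncate f F x)).
  by have := sqr_ge0 (complex.Im (truncate f F x)); lra.
split; split; try by exists F => x; have [] := b x.
- rewrite (_ : (fun x => _) = (fun x => complex.Re (f x)) \_ D).
    by apply/(measurable_restrictT _ mD); apply: (measurable_funS mp); [exact: subIsetl|].
  by apply/funext => x; rewrite patchE /truncate DE; case: ifP.
- rewrite (_ : (fun x => _) = (fun x => complex.Im (f x)) \_ D).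
    by apply/(measurable_restrictT _ mD); apply: (measurable_funS mp); [exact: subIsetl|].
  by apply/funext => x; rewrite patchE /truncate DE; case: ifP.
Qed.

Lemma truncate_eq f F x : period x -> Normc.normc (f x) <= F -> truncate f F x = f x.
Proof. by move=> px fF; rewrite /truncate asboolT. Qed.

Lemma cmeasurableM (f g : R -> R[i]) : cmeasurable period f -> cmeasurable period g ->
  cmeasurable period (fun x => f x * g x).
Proof.
move=> [f1 f2] [g1 g2]; split.
  rewrite (_ : (fun _ => _) = fun x => complex.Re (f x) * complex.Re (g x)
    - complex.Im (f x) * complex.Im (g x)).
    by apply: measurable_funB; exact: measurable_funM.
  by apply/funext => x; case: (f x); case: (g x).
rewrite (_ : (fun _ => _) = fun x => complex.Re (f x) * complex.Im (g x)
    + complex.Im (f x) * complex.Re (g x)).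
  by apply: measurable_funD; exact: measurable_funM.
by apply/funext => x; case: (f x); case: (g x).
Qed.

Lemma cbounded_cmeasurable f : cbounded f -> cmeasurable period f.
Proof. by move=> [[m1 _] [m2 _]]; split; exact: measurable_funTS. Qed.

Lemma fourier_coef_truncate f F (k : int) : 0 <= F -> cmeasurable period f ->
  (\forall x \ae mu, period x -> Normc.normc (f x) <= F) ->
  fourier_coef (truncate f F) k = fourier_coef f k.
Proof.
move=> F0 mf fF; congr (_ * _); apply: cintegral_ae_eq.
- apply: cmeasurableM; apply: cbounded_cmeasurable; first exact: cmeasurable_truncate.
  rewrite (_ : (fun x => _) = fexp (- k)); first exact: cbounded_fexp.
  by apply/funext => x; rewrite /fexp mulrNz mulNr.
- apply: cmeasurableM => //; apply: cbounded_cmeasurable.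
  rewrite (_ : (fun x => _) = fexp (- k)); first exact: cbounded_fexp.
  by apply/funext => x; rewrite /fexp mulrNz mulNr.
- by apply: negligibleS fF => x /=; apply: contra_not => fFx px; rewrite truncate_eq// fFx.
Qed.

Lemma seminorm_energy f (S : R) : seminorm_sqr f = S%:E -> energy_le f S.
Proof.
move=> fS m kap kinj.
rewrite (_ : \sum_i _ = (\sum_i (absz (kap i))%:R * Normc.normc (fourier_coef f (kap i)) ^+ 2)%:C).
  rewrite lecR -lee_fin -fS -sumEFin.
  apply: esum_ge; exists [set` [seq kap i | i <- enum 'I_m]].
    by split => //; exact: finite_seq.
  rewrite -fsbig_seq; last by rewrite map_inj_uniq ?enum_uniq.
  by rewrite [leRHS]big_map big_enum.
rewrite rmorph_sum; apply: eq_bigr => i _.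
by rewrite rmorphM rmorphXn/= rmorph_nat.
Qed.

End Truncation.

(** * Real test functions of class C^3 *)

Section Real_test_function.
Variable R : realType.
Local Notation mu := (@lebesgue_measure R).

Lemma C3_is_derive (g : R -> R) i : continuously_differentiable 3 g -> (i < 3)%N ->
  forall x : R, is_derive x (1 : R) (derive1n i g) (derive1n i.+1 g x).
Proof.
move=> [dg _] i3 x; apply: DeriveDef; first exact: dg.
by rewrite derive1nS derive1E.
Qed.

Lemma C3_continuous (g : R -> R) i : continuously_differentiable 3 g -> (i <= 3)%N ->
  continuous (derive1n i g).
Proof.
move=> Cg; rewrite leq_eqVlt => /orP[/eqP ->|i3]; first by have [] := Cg.
exact/is_derive_continuous/C3_is_derive.
Qed.

Lemma bounded_on_itv (h : R -> R) (L : R) : 0 <= L -> continuous h ->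
  exists x0, forall x, 0 <= x <= L -> `|h x| <= `|h x0|.
Proof.
move=> L0 ch.
have cnh : continuous (fun x => `|h x|) by move=> x; apply: cvg_norm; exact: ch.
have [x0 _ hx0] := EVT_max L0 (continuous_subspaceT cnh).
by exists x0 => x xL; apply: hx0; rewrite in_itv.
Qed.

Lemma cbounded_comp_sqr (f : R -> R[i]) (g : R -> R) F : cbounded f ->
  (forall x, Normc.normc (f x) <= F) -> continuous g ->
  cbounded (fun x => (g (Normc.normc (f x) ^+ 2))%:C).
Proof.
move=> [[m1 _] [m2 _]] fF cg; apply: cbounded_real; split.
  apply: (measurableT_comp (f := g)); first exact: continuous_measurable_fun.
  under eq_fun do rewrite sqr_normc_ReIm.
  by apply: measurable_funD; exact: measurable_funX.
have F0 : 0 <= F by apply: le_trans (fF 0); exact: normc_ge0.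
have [x0 hx0] := bounded_on_itv (sqr_ge0 F) cg.
exists `|g x0| => x; apply: hx0.
by rewrite sqr_ge0 /= ler_sqr ?nnegrE ?normc_ge0.
Qed.

(** [K1] and [K2] are values of [|g'|] and [|g''|] at points where these are
    maximal on [[0, F^2]], so they are finite whether or not the norms of the
    majorants are. *)
Lemma real_trace_bound (n : nat) (f : R -> R[i]) (F S : R)
    (U : 'M[R[i]]_n) (d : 'rV[R[i]]_n) (g a1 a2 a3 : R -> R) :
  cbounded f -> (forall x, Normc.normc (f x) <= F) -> energy_le f S ->
  U *m U^h = 1%:M -> (toeplitz n f)^h *m toeplitz n f *m U = U *m diag_mx d ->
  continuously_differentiable 3 g ->
  measurable_fun setT a1 -> measurable_fun setT a2 -> measurable_fun setT a3 ->
  (forall x, `|derive1n 1 g x| <= a1 x) ->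
  (forall x, `|derive1n 2 g x| <= a2 x) ->
  (forall x, `|derive1n 3 g x| <= a3 x) ->
  exists K1 K2 : R,
  [/\ (K1%:E <= Lnorm mu 1 (EFin \o a1) + Lnorm mu 2%:E (EFin \o a2))%E,
      (K2%:E <= Lnorm mu 1 (EFin \o a2) + Lnorm mu 2%:E (EFin \o a3))%E &
  `|\sum_j g (complex.Re (d 0 j)) -
    n%:R / (2 * pi) * \int[mu]_(x in period) g (Normc.normc (f x) ^+ 2)|
    <= S * (K1 + 2 * F ^+ 2 * K2)].
Proof.
move=> bf fF fS UU AU Cg m1 m2 m3 h1 h2 h3.
have L0 : 0 <= F ^+ 2 by exact: sqr_ge0.
have [x1 hx1] := bounded_on_itv L0 (C3_continuous Cg (isT : (1 <= 3)%N)).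
have [x2 hx2] := bounded_on_itv L0 (C3_continuous Cg (isT : (2 <= 3)%N)).
exists `|derive1n 1 g x1|, `|derive1n 2 g x2|; split.
- apply: (@sup_le_norms _ _ _ _ _ _ (C3_is_derive Cg (isT : (1 < 3)%N))) => //.
  exact: C3_continuous.
- apply: (@sup_le_norms _ _ _ _ _ _ (C3_is_derive Cg (isT : (2 < 3)%N))) => //.
  exact: C3_continuous.
have cg : continuous g by exact: (C3_continuous Cg (isT : (0 <= 3)%N)).
have dg := C3_is_derive Cg (isT : (0 < 3)%N).
have dg1 := C3_is_derive Cg (isT : (1 < 3)%N).
have fFC x : `|f x| <= F%:C by rewrite lecR.
have bg := cbounded_comp_sqr bf fF cg.
have cNg : continuous (fun x => - g x) by move=> x; apply: cvgN; exact: cg.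
have bNg := cbounded_comp_sqr bf fF cNg.
set X := (X in `|X|).
have XE : X%:C = \sum_j (g (complex.Re (d 0 j)))%:C -
    n%:R * mean (fun x => (g (Normc.normc (f x) ^+ 2))%:C).
  rewrite mean_real /X rmorphB rmorph_sum/=; congr (_ - _).
  by rewrite -(rmorph_nat (real_complex R)) -rmorphM/= mulrA.
rewrite ler_norml -lerNl; apply/andP; split; rewrite -lecR.
  have -> : (- X)%:C = \sum_j (- g (complex.Re (d 0 j)))%:C -
      n%:R * mean (fun x => (- g (Normc.normc (f x) ^+ 2))%:C).
    rewrite rmorphN/= XE opprB addrC; congr (_ + _).
      by rewrite -sumrN; apply: eq_bigr => j _; rewrite rmorphN.
    rewrite -[RHS]mulrN -meanN//.
    by congr (_ * mean _); apply/funext => x; rewrite rmorphN/= opprK.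
  apply: (@trace_upper _ n f F S bf fFC fS U d UU AU (fun x => - g x)
    (fun x => - derive1n 1 g x)) => //.
    by move=> t tL; rewrite normrN hx1.
  have dNg (x : R) : is_derive x (1 : R) (fun x => - g x) (- derive1n 1 g x).
    by have := dg x; exact: is_deriveN.
  have dNg1 (x : R) : is_derive x (1 : R) (fun x => - derive1n 1 g x) (- derive1n 2 g x).
    by have := dg1 x; exact: is_deriveN.
  move=> t r tL rL; apply: (taylor_upper dNg dNg1) tL rL => x xL.
  by rewrite normrN hx2.
rewrite XE; apply: (@trace_upper _ n f F S bf fFC fS U d UU AU g (derive1n 1 g)) => //.
by move=> t r tL rL; apply: (taylor_upper dg dg1) tL rL.
Qed.

End Real_test_function.

(** * Complex test functions *)

Section Assembly.
Variable R : realType.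

Lemma normc_le_ReIm (z : R[i]) :
  Normc.normc z <= `|complex.Re z| + `|complex.Im z|.
Proof.
rewrite -ler_sqr ?nnegrE ?normc_ge0 ?addr_ge0// sqr_normc_ReIm.
rewrite -(real_normK (num_real (complex.Re z))) -(real_normK (num_real (complex.Im z))).
have := mulr_ge0 (normr_ge0 (complex.Re z)) (normr_ge0 (complex.Im z)).
by rewrite sqrrD; lra.
Qed.

Lemma normr_Re_le (z : R[i]) : `|complex.Re z| <= Normc.normc z.
Proof.
rewrite -ler_sqr ?nnegrE ?normc_ge0// sqr_normc_ReIm real_normK ?num_real//.
by rewrite lerDl sqr_ge0.
Qed.

Lemma normr_Im_le (z : R[i]) : `|complex.Im z| <= Normc.normc z.
Proof.
rewrite -ler_sqr ?nnegrE ?normc_ge0// sqr_normc_ReIm real_normK ?num_real//.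
by rewrite lerDr sqr_ge0.
Qed.

Lemma measurable_normc D (h : R -> R[i]) : measurable D ->
  cmeasurable D h -> measurable_fun D (fun x => Normc.normc (h x)).
Proof.
move=> mD [m1 m2]; rewrite (_ : (fun x => _) = fun x =>
    Num.sqrt (complex.Re (h x) ^+ 2 + complex.Im (h x) ^+ 2)).
  apply: (measurableT_comp (f := @Num.sqrt R)).
    by apply: continuous_measurable_fun; exact: sqrt_continuous.
  by apply: measurable_funD; exact: measurable_funX.
by apply/funext => x; case: (h x).
Qed.

Lemma cmeasurable_comp_sqr (f G : R -> R[i]) : cmeasurable period f ->
  continuous (fun x => complex.Re (G x)) -> continuous (fun x => complex.Im (G x)) ->
  cmeasurable period (fun x => G (Normc.normc (f x) ^+ 2)).
Proof.
move=> mf c1 c2.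
have m : measurable_fun period (fun x => Normc.normc (f x) ^+ 2).
  by apply: measurable_funX; apply: measurable_normc => //; exact: measurable_period.
split.
  apply: (measurableT_comp (f := fun x => complex.Re (G x))) m.
  exact: continuous_measurable_fun.
apply: (measurableT_comp (f := fun x => complex.Im (G x))) m.
exact: continuous_measurable_fun.
Qed.

Lemma gram_spectral n (A : 'M[R[i]]_n) (M := A^h *m A) (U := (spectralmx M)^h) :
  U *m U^h = 1%:M /\ M *m U = U *m diag_mx (spectral_diag M).
Proof.
have PP : spectralmx M *m U = 1%:M by apply/unitarymxP; exact: spectral_unitarymx.
have UP : U *m spectralmx M = 1%:M by exact: mulmx1C.
split; first by rewrite /U hermK.
have MM : M \is normalmx.
  by apply/normalmxP; rewrite /M hermM hermK.
have /orthomx_spectralP {1}-> := MM.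
rewrite -!mulmxA PP mulmx1; congr (_ *m _).
by rewrite -[LHS]mul1mx -UP -mulmxA mulmxV ?mulmx1// spectral_unit.
Qed.

End Assembly.

Local Open Scope complex_scope.

Theorem theorem1 (R : realType) (f : R -> R[i]) (G : R -> R[i])
    (f_Linfty : Linfty f)
    (f_seminorm : (seminorm_sqr f < +oo)%E)
    (G_C3c : C3c G)
    (n : nat) (n_ge1 : (1 <= n)%N) :
  ((Normc.normc
      (\sum_(j < n) G (singular_value (toeplitz n f) j ^+ 2)
       - (n%:R / (2 * pi))%:C
         * cintegral period (fun t => G (Normc.normc (f t) ^+ 2))))%:E
   <= 2%:E * seminorm_sqr f * (c1 G + 2%:E * c2 G * Linfty_norm f ^+ 2))%E.
Proof.
have [F F0 [FE fF]] := Linfty_norm_ae f_Linfty.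
have [mf _] := f_Linfty; have [CR CI _] := G_C3c.
have sem0 : (0 <= seminorm_sqr f)%E.
  by apply: esum_ge0 => k _; rewrite lee_fin mulr_ge0// sqr_ge0.
have [S SE] : exists S, seminorm_sqr f = S%:E.
  by exists (fine (seminorm_sqr f)); rewrite fineK// ge0_fin_numE.
have S0 : 0 <= S by rewrite SE in sem0.
pose f' := truncate f F.
have bf' : cbounded f' by exact: cmeasurable_truncate.
have f'F x : Normc.normc (f' x) <= F by exact: truncate_le.
have coefE k : fourier_coef f' k = fourier_coef f k by exact: fourier_coef_truncate.
have f'S : energy_le f' S.
  move=> m kap kinj; have := seminorm_energy SE kinj.
  by under [in X in _ -> X]eq_bigr do rewrite coefE.
have TE : toeplitz n f = toeplitz n f' by apply/matrixP => a b; rewrite !mxE coefE.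
have -> : cintegral period (fun t => G (Normc.normc (f t) ^+ 2)) =
          cintegral period (fun t => G (Normc.normc (f' t) ^+ 2)).
  apply: cintegral_ae_eq.
  - apply: cmeasurable_comp_sqr => //.
    + exact: (C3_continuous CR (isT : (0 <= 3)%N)).
    + exact: (C3_continuous CI (isT : (0 <= 3)%N)).
  - apply: cmeasurable_comp_sqr; first exact: cbounded_cmeasurable.
    + exact: (C3_continuous CR (isT : (0 <= 3)%N)).
    + exact: (C3_continuous CI (isT : (0 <= 3)%N)).
  - apply: negligibleS fF => x /=; apply: contra_not => fFx px.
    by rewrite /f' truncate_eq// fFx.
have [UU AU] := gram_spectral (toeplitz n f').
rewrite TE {TE}.
move: UU AU; set M := _ *m toeplitz n f'; set U := (spectralmx M)^h => UU AU.
set d := spectral_diag M in AU.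
have svE j : singular_value (toeplitz n f') j ^+ 2 = complex.Re (d 0 j).
  rewrite sqr_sqrtr//.
  have := eigenvalue_ge0 UU AU j; by rewrite lecE => /andP[].
have mder k : (k <= 3)%N -> measurable_fun setT (fun x => Normc.normc (cderive k G x)).
  move=> k3; apply: measurable_normc => //.
  by split; apply: continuous_measurable_fun;
    [exact: (C3_continuous CR k3)|exact: (C3_continuous CI k3)].
have [K1 [K2 [K1R K2R HR]]] := real_trace_bound bf' f'F f'S UU AU CR
  (mder 1%N isT) (mder 2%N isT) (mder 3%N isT)
  (fun x => normr_Re_le (cderive 1 G x)) (fun x => normr_Re_le (cderive 2 G x))
  (fun x => normr_Re_le (cderive 3 G x)).
have [L1 [L2 [L1R L2R HI]]] := real_trace_bound bf' f'F f'S UU AU CI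
  (mder 1%N isT) (mder 2%N isT) (mder 3%N isT)
  (fun x => normr_Im_le (cderive 1 G x)) (fun x => normr_Im_le (cderive 2 G x))
  (fun x => normr_Im_le (cderive 3 G x)).
set Z := (X in Normc.normc X).
have ZR : complex.Re Z = \sum_j complex.Re (G (complex.Re (d 0 j))) -
    n%:R / (2 * pi) * \int[lebesgue_measure]_(x in period) complex.Re (G (Normc.normc (f' x) ^+ 2)).
  rewrite /Z raddfB raddf_sum/= mul0r subr0; congr (_ - _).
  by apply: eq_bigr => j _; rewrite svE.
have ZI : complex.Im Z = \sum_j complex.Im (G (complex.Re (d 0 j))) -
    n%:R / (2 * pi) * \int[lebesgue_measure]_(x in period) complex.Im (G (Normc.normc (f' x) ^+ 2)).
  rewrite /Z raddfB raddf_sum/= mul0r addr0; congr (_ - _).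
  by apply: eq_bigr => j _; rewrite svE.
rewrite -ZR in HR; rewrite -ZI in HI.
have Zle : Normc.normc Z <= S * ((K1 + L1) + 2 * F ^+ 2 * (K2 + L2)).
  by apply: le_trans (normc_le_ReIm Z) _; lra.
have sq2 : (1%:E <= (Num.sqrt 2 : R)%:E)%E.
  by rewrite lee_fin -[leLHS]sqrtr1 ler_wsqrtr// ler1n.
(* The constants [2] and [sqrt 2] in [c1] and [c2] exceed those of the
   Sobolev-type bound; one factor [2] pays for the real and imaginary parts. *)
have cle (h k : R -> R[i]) (a b : R)
    (c := (2%:E * Lp_norm 1 h + (Num.sqrt 2)%:E * Lp_norm 2%:E k)%E) :
    (a%:E <= Lp_norm 1 h + Lp_norm 2%:E k)%E -> (b%:E <= Lp_norm 1 h + Lp_norm 2%:E k)%E ->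
    ((a + b)%:E <= 2%:E * c)%E.
  move=> ha hb; have N1 : (0 <= Lp_norm 1 h)%E by exact: Lnorm_ge0.
  have N2 : (0 <= Lp_norm 2%:E k)%E by exact: Lnorm_ge0.
  have hc : (Lp_norm 1 h + Lp_norm 2%:E k <= c)%E.
    by apply: leeD; apply: lee_pemull => //; rewrite lee_fin ler1n.
  rewrite EFinD (_ : 2%:E = 1 + 1)%E; last by rewrite -EFinD.
  rewrite ge0_muleDl// !mul1e.
  by apply: leeD; [exact: le_trans ha hc|exact: le_trans hb hc].
have h1 : ((K1 + L1)%:E <= 2%:E * c1 G)%E.
  exact: (cle (cderive 1 G) (cderive 2 G) K1 L1 K1R L1R).
have h2 : ((K2 + L2)%:E <= 2%:E * c2 G)%E.
  exact: (cle (cderive 2 G) (cderive 3 G) K2 L2 K2R L2R).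
have c10 : (0 <= c1 G)%E.
  by apply: adde_ge0; apply: mule_ge0; rewrite ?lee_fin ?sqrtr_ge0//; exact: Lnorm_ge0.
have c20 : (0 <= c2 G)%E.
  by apply: adde_ge0; apply: mule_ge0; rewrite ?lee_fin ?sqrtr_ge0//; exact: Lnorm_ge0.
apply: (@le_trans _ _ (S * ((K1 + L1) + 2 * F ^+ 2 * (K2 + L2)))%:E); first by rewrite lee_fin.
rewrite FE SE -EFin_expe (muleC 2%:E S%:E) -muleA EFinM.
apply: lee_wpmul2l; first by rewrite lee_fin.
have F20 : 0 <= F ^+ 2 by exact: sqr_ge0.
move: (c1 G) (c2 G) h1 h2 c10 c20 => e1 e2 h1 h2 e10 e20.
have F20E : (0 <= (F ^+ 2)%:E)%E by rewrite lee_fin.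
rewrite ge0_muleDr//; last by apply: mule_ge0 => //; exact: mule_ge0.
rewrite EFinD; apply: leeD => //.
rewrite (_ : 2%:E * (2%:E * e2 * _) = (2 * F ^+ 2)%:E * (2%:E * e2))%E; last first.
  by rewrite [in RHS]EFinM -[RHS]muleA [X in _ = (_ * X)%E]muleC.
rewrite EFinM; apply: lee_wpmul2l => //.
by rewrite lee_fin mulr_ge0.
Qed.
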